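(* Let $\Omega\subset\mathbb{R}$ be a bounded open interval, $b\in\mathbb{R}\setminus\{0\}$ constant, $f\in L_2(\Omega)$, $\mathcal{T}_h$ a mesh of $\Omega$, and $k'\ge 0$ an integer. Let $u\in L_2(\Omega)$ be the solution of $-(u,b\nabla v)=(f,v)$ for all $v\in H^1_+(\Omega)$, and let $u_h\in L_2(\Omega)$ be arbitrary subject to the $\psi_a$-orthogonality $$(f,\psi_a)_{\omega_a}+(u_h,b\nabla\psi_a)_{\omega_a}=0\qquad\forall\,a\in\mathcal{V}_h^{\mathrm{int}}\cup\mathcal{V}_h^{\partial_-\Omega}.$$ Let $s_h=\sum_{a\in\mathcal{V}_h}\psi_a s_h^a$, where for each $a\in\mathcal{V}_h$, $s_h^a\in\mathcal{P}^{k'}(\mathcal{T}_a)\cap H^1(\omega_a)$ is the solution of $$(b\nabla(\psi_a s_h^a),v_h)_{\omega_a}=(f\psi_a+(b\nabla\psi_a)u_h,\,v_h)_{\omega_a}\qquad\forall\,v_h\in\mathcal{P}^{k'}(\mathcal{T}_a).$$ Then $$\|u-u_h\|\le\eta:=\Bigl\{\sum_{K\in\mathcal{T}_h}\bigl(\eta_{\mathrm{NC},K}+\eta_{\mathrm{Osc},K}\bigr)^2\Bigr\}^{1/2},$$ where $$\eta_{\mathrm{NC},K}:=\|u_h-s_h\|_K,\qquad \eta_{\mathrm{Osc},K}:=\frac{h_K}{\pi|b|}\,\bigl\|(I-\Pi_{\mathcal{P}^{k'}(\mathcal{T}_h)})f\bigr\|_K,$$ with $\Pi_{\mathcal{P}^{k'}(\mathcal{T}_h)}$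 the $L_2(\Omega)$-orthogonal projection onto $\mathcal{P}^{k'}(\mathcal{T}_h)$.
   Context: Notation: $(v,w)_D=\int_D vw$, $\|v\|_D=(v,v)_D^{1/2}$, with the subscript dropped when $D=\Omega$; $\nabla v=v'$. With $n=\pm1$ the outward unit normal at the endpoints of $\Omega$, $\partial_\pm\Omega=\{x\in\partial\Omega:\pm b\,n(x)>0\}$ ($-$ inflow, $+$ outflow), and $H^1_+(\Omega)=\{w\in H^1(\Omega): w=0\text{ on }\partial_+\Omega\}$. The formulation defining $u$ is the (well-posed) ultra-weak form of $b\nabla u=f$ in $\Omega$, $u=0$ on $\partial_-\Omega$. Mesh: $\mathcal{T}_h$ is a finite division of $\Omega$ into non-overlapping intervals covering $\Omega$, shape regular in the sense that any two neighboring intervals have comparable lengths up to a constant $\kappa_{\mathcal{T}_h}$; $h_K$ is the diameter of $K\in\mathcal{T}_h$. The set of vertices is $\mathcal{V}_h=\mathcal{V}_h^{\mathrm{int}}\cup\mathcal{V}_h^{\partial_-\Omega}\cup\mathcal{V}_h^{\partial_+\Omega}$ (interior, inflow and outflow vertices). For $a\in\mathcal{V}_h$, $\mathcal{T}_a$ is the set of elements having $a$ as a vertex, $\omega_a$ the corresponding open interval, and $\psi_a$ the continuous piecewise affine hat function equal to $1$ at $a$ and $0$ at all other vertices. $\mathcal{P}^{m}(\mathcal{T})$ denotes piecewise polynomials of degree at most $m$ on $\mathcal{T}$ (no continuity imposed). The local solutions $s_h^a$ exist and are unique; products $\psi_a s_h^a$ are extended by zero outside $\omega_a$. *)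

(* Defs.v *)
From HB Require Import structures.
From mathcomp Require Export all_boot all_order all_algebra.
From mathcomp Require Export all_classical all_reals all_analysis.
Export Order.TTheory GRing.Theory Num.Theory.
Export numFieldNormedType.Exports.

Set Implicit Arguments.
Unset Strict Implicit.
Unset Printing Implicit Defensive.

Local Open Scope classical_set_scope.
Local Open Scope ring_scope.

(* Elements of L_2(D) are represented by functions R -> R; every notion below
   depends only on the values taken almost everywhere on D. *)
Section L2.
Variable R : realType.
Implicit Types (D : set R) (v w : R -> R).

Definition L2 D v : Prop := v \_ D \in Lfun (@lebesgue_measure R) 2%:E.

Definition ip D v w : R := \int[@lebesgue_measure R]_(x in D) (v x * w x).

Definition L2norm D v : R := Num.sqrt (ip D v v).

End L2.

Section Sobolev.
Variable R : realType.
Implicit Types (D : set R) (v g : R -> R) (alpha beta b x y : R).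

(* C^1_c(D) *)
Definition test_function D (phi : R -> R) : Prop :=
  [/\ forall x, derivable phi x 1, continuous (derive1 phi),
      compact (closure [set x | phi x != 0]) &
      closure [set x | phi x != 0] `<=` D].

(* v belongs to H^1(D) and g represents its weak derivative; g is unique up to
   equality almost everywhere on D. *)
Definition H1_grad D v g : Prop :=
  [/\ L2 D v, L2 D g &
      forall phi, test_function D phi -> ip D v (derive1 phi) = - ip D g phi].

Definition H1 D v : Prop := exists g, H1_grad D v g.

Definition outer_normal alpha beta x : R :=
  if x == alpha then -1 else if x == beta then 1 else 0.

Definition inflow alpha beta b : set R :=
  [set x | (x = alpha \/ x = beta) /\ b * outer_normal alpha beta x < 0].

Definition outflow alpha beta b : set R :=
  [set x | (x = alpha \/ x = beta) /\ 0 < b * outer_normal alpha beta x].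

(* Boundary values are those of the representative that is continuous up to
   the boundary. *)
Definition H1_plus alpha beta b v : Prop :=
  H1 `]alpha, beta[ v /\
  exists w : R -> R,
    [/\ {within `[alpha, beta], continuous w},
        v = w %[ae @lebesgue_measure R in [set` `]alpha, beta[]] &
        forall x, outflow alpha beta b x -> w x = 0].

End Sobolev.

Record mesh (R : realType) (alpha beta kappa : R) := Mesh {
  nodes : seq R;
  nodes_partition : itv_partition alpha beta nodes;
  nodes_regular : forall i : nat, (i.+1 < size nodes)%N ->
    let x := nth beta (alpha :: nodes) in
    x i.+1 - x i <= kappa * (x i.+2 - x i.+1) /\
    x i.+2 - x i.+1 <= kappa * (x i.+1 - x i) }.

Section Mesh.
Variables (R : realType) (alpha beta kappa : R) (T : mesh alpha beta kappa).

(* Elements are numbered 0, ..., ncell - 1 and vertices 0, ..., ncell. *)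
Definition ncell : nat := size (nodes T).

(* The default value gives vertex ncell.+1 = vertex ncell = beta; since also
   0.-1 = 0, the one-sided patches of the two boundary vertices need no
   separate treatment in omega and hat. *)
Definition vertex (i : nat) : R := nth beta (alpha :: nodes T) i.

Definition cell (i : 'I_ncell) : set R := `]vertex i, vertex i.+1[.

Definition hcell (i : 'I_ncell) : R := vertex i.+1 - vertex i.

Definition patch (a : 'I_ncell.+1) : set 'I_ncell :=
  [set i | i = a :> nat \/ i.+1 = a :> nat].

Definition omega (a : 'I_ncell.+1) : set R := `]vertex a.-1, vertex a.+1[.

Definition hat (a : 'I_ncell.+1) (x : R) : R :=
  if vertex a.-1 < x <= vertex a then
    (x - vertex a.-1) / (vertex a - vertex a.-1)
  else if vertex a <= x < vertex a.+1 then
    (vertex a.+1 - x) / (vertex a.+1 - vertex a)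
  else 0.

(* P^m(S) for a set S of elements. *)
Definition broken_poly (m : nat) (S : set 'I_ncell) (v : R -> R) : Prop :=
  forall i, S i -> exists p : {poly R},
    (size p <= m.+1)%N /\ forall x, cell i x -> v x = p.[x].

(* pf is the L_2-orthogonal projection of f onto P^m(T). *)
Definition is_L2proj (m : nat) (f pf : R -> R) : Prop :=
  broken_poly m setT pf /\
  forall v, broken_poly m setT v -> ip `]alpha, beta[ (f \- pf) v = 0.

(* The local problem at a. *)
Definition local_solution (b : R) (m : nat) (f uh : R -> R)
    (a : 'I_ncell.+1) (s : R -> R) : Prop :=
  [/\ broken_poly m (patch a) s, H1 (omega a) s &
      forall dpsi dpsis : R -> R,
        H1_grad (omega a) (hat a) dpsi ->
        H1_grad (omega a) (hat a \* s) dpsis ->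
      forall v, broken_poly m (patch a) v ->
        ip (omega a) (fun x => b * dpsis x) v =
        ip (omega a) (fun x => f x * hat a x + b * dpsi x * uh x) v].

Definition reconstruction (s : 'I_ncell.+1 -> R -> R) (x : R) : R :=
  \sum_(a < ncell.+1) ((hat a \* s a) \_ (omega a)) x.

Definition eta_NC (uh sh : R -> R) (i : 'I_ncell) : R :=
  L2norm (cell i) (uh \- sh).

Definition eta_Osc (b : R) (f pf : R -> R) (i : 'I_ncell) : R :=
  hcell i / (pi * `|b|) * L2norm (cell i) (f \- pf).

Definition eta (b : R) (f pf uh sh : R -> R) : R :=
  Num.sqrt (\sum_(i < ncell) (eta_NC uh sh i + eta_Osc b f pf i) ^+ 2).

End Mesh.

(* u solves the ultra-weak form of b u' = f, u = 0 at the inflow. *)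
Definition ultra_weak_solution (R : realType) (alpha beta b : R)
    (f u : R -> R) : Prop :=
  L2 `]alpha, beta[ u /\
  forall v dv, H1_plus alpha beta b v -> H1_grad `]alpha, beta[ v dv ->
    - ip `]alpha, beta[ u (fun x => b * dv x) = ip `]alpha, beta[ f v.

(* Main.v *)
Require Import Defs.
From mathcomp Require Import measurable_realfun ring lra zify.

Set Implicit Arguments.
Unset Strict Implicit.
Unset Printing Implicit Defensive.

Local Open Scope classical_set_scope.
Local Open Scope ring_scope.

(** The ultra-weak solution is explicit: almost everywhere, [u] is the
    primitive [U] of [f / b] that vanishes at the inflow endpoint
    ([ultra_weak_solution_unique]). So [U] and the reconstruction [s_h] can be
    compared by comparing their derivatives cell by cell.

    On a cell only the two hat functions of its endpoints are nonzero, and they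
    sum to [1]. Adding the two local problems, tested with a polynomial [r]
    supported on the cell, the terms with [uh] cancel and
    [(b s_h', r) = (f, r)] remains ([recon_poly_equation]): [b s_h'] is the
    L2 projection of [f] on the cell. Taking [r = 1], the functions [U] and
    [s_h] have the same increment over every cell. Both are continuous: a
    piecewise polynomial in H^1 cannot jump at a node
    ([H1_pw_poly_continuous]). Both vanish at the inflow endpoint, for [s_h]
    because of the orthogonality assumption at that vertex
    ([orthogonality_increment]). Hence [U = s_h] at all vertices
    ([recon_poly_vertex]).

    It follows that on a cell [U - s_h] is the primitive, vanishing at both
    ends, of [1 / b] times the projection error of [f], and the Poincare
    inequality with the constant [h / pi] ([poincare]) bounds it by the data
    oscillation. The triangle inequality on each cell ([cell_error]) and
    summation over the cells conclude.

    Every integration by parts involves functions known only through integrable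
    derivatives; all of them reduce to Fubini's theorem on a triangle
    ([oint_by_parts]). *)


(** * Integrals over open intervals *)

Section IntervalIntegral.
Variable R : realType.
Notation mu := (@lebesgue_measure R).
Implicit Types (a b c x : R) (f g h k : R -> R).

Definition itg a b f := mu.-integrable `]a, b[ (EFin \o f).
Definition oint a b f : R := \int[mu]_(x in `]a, b[) f x.

Lemma itg_meas a b f : itg a b f -> measurable_fun `]a, b[ f.
Proof. by move=> /measurable_int/measurable_EFinP. Qed.

Lemma itg_sub a b c d f : a <= c -> d <= b -> itg a b f -> itg c d f.
Proof.
move=> ac db; apply: integrableS => //.
by apply: subset_itv; rewrite bnd_simp.
Qed.

Lemma eq_oint a b f g : (forall x, a < x < b -> f x = g x) ->
  oint a b f = oint a b g.
Proof.
by move=> fg; apply: eq_Rintegral => x; rewrite inE/= in_itv/= => /fg.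
Qed.

Lemma eq_itg a b f g : (forall x, a < x < b -> f x = g x) ->
  itg a b f -> itg a b g.
Proof.
move=> fg; apply: eq_integrable => //= x; rewrite inE => xab.
by rewrite fg.
Qed.

Lemma itgD a b f g : itg a b f -> itg a b g -> itg a b (fun x => f x + g x).
Proof.
move=> intf intg; rewrite /itg.
have -> : EFin \o (fun x => f x + g x) = ((EFin \o f) \+ (EFin \o g))%E by [].
exact: integrableD.
Qed.

Lemma itgZ a b r f : itg a b f -> itg a b (fun x => r * f x).
Proof.
move=> intf; rewrite /itg.
have -> : EFin \o (fun x => r * f x) = (fun x => r%:E * (EFin \o f) x)%E by [].
exact: integrableZl.
Qed.

Lemma itgB a b f g : itg a b f -> itg a b g -> itg a b (fun x => f x - g x).
Proof.
move=> intf intg; rewrite /itg.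
have -> : EFin \o (fun x => f x - g x) = ((EFin \o f) \- (EFin \o g))%E by [].
exact: integrableB.
Qed.

Lemma ointD a b f g : itg a b f -> itg a b g ->
  oint a b (fun x => f x + g x) = oint a b f + oint a b g.
Proof. by move=> intf intg; rewrite /oint RintegralD. Qed.

Lemma ointB a b f g : itg a b f -> itg a b g ->
  oint a b (fun x => f x - g x) = oint a b f - oint a b g.
Proof. by move=> intf intg; rewrite /oint RintegralB. Qed.

Lemma ointZ a b r f : itg a b f ->
  oint a b (fun x => r * f x) = r * oint a b f.
Proof. by move=> intf; rewrite /oint RintegralZl. Qed.

Lemma oint_ge0 a b f : (forall x, a < x < b -> 0 <= f x) -> 0 <= oint a b f.
Proof. by move=> f0; apply: Rintegral_ge0 => x; rewrite /= in_itv/= => /f0. Qed.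

Lemma oint_empty a b f : b <= a -> oint a b f = 0.
Proof.
by move=> ba; rewrite /oint set_itv_ge ?Rintegral_set0// bnd_simp -leNgt.
Qed.

Lemma itg_empty a b f : b <= a -> itg a b f.
Proof.
move=> ba; rewrite /itg set_itv_ge; first exact: integrable_set0.
by rewrite bnd_simp -leNgt.
Qed.

Lemma oint_split a b c f : a <= c -> c <= b -> itg a b f ->
  oint a b f = oint a c f + oint c b f.
Proof.
move=> ac cb intf.
move: ac; rewrite le_eqVlt => /predU1P[<-|ac].
  by rewrite (@oint_empty a a)// add0r.
move: cb; rewrite le_eqVlt => /predU1P[<-|cb].
  by rewrite (@oint_empty c c)// addr0.
have := @Rintegral_itvB R f (BRight a) (BLeft b) c intf.
rewrite !bnd_simp => /(_ (ltW ac) cb) /eqP.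
rewrite subr_eq addrC => /eqP; rewrite /oint => ->.
by rewrite -Rintegral_itv_bndo_bndc//; exact: (itg_sub _ (ltW cb) intf).
Qed.

Lemma itg_glue a b c f : itg a c f -> itg c b f -> itg a b f.
Proof.
move=> iac icb.
have [ca|ac] := leP c a.
  by apply: itg_sub icb => //.
have [bc|cb] := leP b c; first exact: itg_sub iac.
rewrite /itg (@itv_bndbnd_setU _ _ (BRight a) (BLeft c) (BLeft b)); last 2 first.
  by rewrite bnd_simp.
  by rewrite bnd_simp ltW.
move: (icb) => /integrableP[mcb fcb].
have mcb' : measurable_fun `[c, b[ (EFin \o f).
  exact/emeasurable_fun_itv_obnd_cbndP.
have i2 : mu.-integrable `[c, b[ (EFin \o f).
  apply/integrableP; split => //.
  by rewrite -integral_itv_obnd_cbnd//; apply: measurableT_comp.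
move: iac i2 => /integrableP[mac fac] /integrableP[_ f2].
apply/integrableP; split; first by apply/measurable_funU.
rewrite ge0_integral_setU//=.
- by rewrite lte_add_pinfty.
- apply/measurable_funU => //; split; apply/measurable_EFinP;
    by apply: measurableT_comp => //; exact/measurable_EFinP.
- apply/disj_setPS => y [/=]; rewrite 2!in_itv/= => /andP[_ yx] /andP[].
  by rewrite leNgt yx.
Qed.

Definition cont_on a b f := {within `[a, b], continuous f}.

Lemma cont_on_meas a b f : cont_on a b f -> measurable_fun `]a, b[ f.
Proof.
move=> cf; apply: (@measurable_funS _ _ _ _ `[a, b]) => //.
  exact: subset_itv_oo_cc.
exact: subspace_continuous_measurable_fun.
Qed.

Lemma cont_on_bounded a b f : cont_on a b f ->
  exists M, forall x, a <= x <= b -> `|f x| <= M.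
Proof.
move=> cf; have [ab|ba] := leP a b; last first.
  exists 0 => x /andP[ax xb].
  by have := lt_le_trans ba (le_trans ax xb); rewrite ltxx.
have cn : {within `[a, b], continuous (fun x => `|f x|)}.
  by move=> x; apply: continuous_comp (cf x) _; exact: norm_continuous.
have [c _ hc] := @EVT_max R (fun x => `|f x|) a b ab cn.
by exists `|f c| => x xab; apply: hc; rewrite in_itv.
Qed.

Lemma itgM_bounded a b f g M : measurable_fun `]a, b[ f ->
  (forall x, a < x < b -> `|f x| <= M) -> itg a b g ->
  itg a b (fun x => f x * g x).
Proof.
move=> mf fM intg.
have := @integrableMr _ _ R mu `]a, b[ _ f (EFin \o g) mf _ intg.
apply => //.
exists M; split; first exact: num_real.
move=> x Mx t /=; rewrite in_itv/= => tab.
by rewrite (le_trans (fM _ tab))// ltW.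
Qed.

Lemma itgM_cont a b f g : cont_on a b f -> itg a b g ->
  itg a b (fun x => f x * g x).
Proof.
move=> cf intg; have [M fM] := cont_on_bounded cf.
apply: (itgM_bounded (cont_on_meas cf)) intg => x /andP[ax xb].
by apply: fM; rewrite !ltW.
Qed.

Lemma itg_cst a b r : itg a b (cst r).
Proof.
have [ab|ba] := ltP a b; last exact: itg_empty.
apply: measurable_bounded_integrable => //=.
  by rewrite lebesgue_measure_itv/= lte_fin ab -EFinB ltry.
exact: bounded_cst.
Qed.

Lemma itg_cont a b f : cont_on a b f -> itg a b f.
Proof.
move=> cf; have := itgM_cont cf (itg_cst a b 1).
by apply: eq_itg => x _; rewrite /= mulr1.
Qed.

Lemma cont_onM a b f g : cont_on a b f -> cont_on a b g ->
  cont_on a b (fun x => f x * g x).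
Proof. by move=> cf cg x; apply: cvgM; [exact: cf|exact: cg]. Qed.

Lemma cont_onD a b f g : cont_on a b f -> cont_on a b g ->
  cont_on a b (fun x => f x + g x).
Proof. by move=> cf cg x; apply: cvgD; [exact: cf|exact: cg]. Qed.

Lemma cont_onB a b f g : cont_on a b f -> cont_on a b g ->
  cont_on a b (fun x => f x - g x).
Proof. by move=> cf cg x; apply: cvgB; [exact: cf|exact: cg]. Qed.

Lemma cont_on_cst a b r : cont_on a b (cst r).
Proof. by move=> x; exact: cvg_cst. Qed.

Lemma cont_onT a b f : continuous f -> cont_on a b f.
Proof. exact: continuous_subspaceT. Qed.

Lemma cont_on_sub a b c d f : a <= c -> d <= b -> cont_on a b f -> cont_on c d f.
Proof.
move=> ac db; apply: continuous_subspaceW.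
by apply: subset_itv; rewrite bnd_simp.
Qed.

Lemma eq_cont_on a b f g : (forall x, a <= x <= b -> f x = g x) ->
  cont_on a b f -> cont_on a b g.
Proof.
move=> fg; apply: subspace_eq_continuous => x.
by rewrite inE/= in_itv/= => /fg.
Qed.

Lemma oint_closed a b f : itg a b f ->
  oint a b f = \int[mu]_(x in `[a, b]) f x.
Proof.
move=> intf; have [ab|ba] := ltP a b.
  rewrite /oint Rintegral_itv_obnd_cbnd// Rintegral_itv_bndo_bndc//.
  have := itg_meas intf => mf.
  move: intf => /integrableP[m1 i1].
  apply/integrableP; split; first exact/emeasurable_fun_itv_obnd_cbndP.
  rewrite -integral_itv_obnd_cbnd//.
  by apply: measurableT_comp.
rewrite oint_empty//; move: ba; rewrite le_eqVlt => /predU1P[->|ba].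
  by rewrite set_itv1 Rintegral_set1.
by rewrite set_itv_ge ?Rintegral_set0// bnd_simp -ltNge.
Qed.

(** The Newton-Leibniz formula. *)
Lemma oint_deriv a b (F f : R -> R) : a <= b ->
  (forall x, a <= x <= b -> is_derive x 1 F (f x)) -> cont_on a b f ->
  oint a b f = F b - F a.
Proof.
rewrite le_eqVlt => /predU1P[<-|ab] dF cf.
  by rewrite oint_empty// subrr.
have cF x : a <= x <= b -> {for x, continuous F}.
  move=> /dF xab; apply/differentiable_continuous/derivable1_diffP.
  exact: ex_derive.
have intf := itg_cont cf.
rewrite oint_closed// /Rintegral (@continuous_FTC2 R f F a b)//.
- split.
  + move=> x; rewrite in_itv/= => /andP[ax xb].
    by apply: ex_derive; apply: dF; rewrite !ltW.
  + by apply/cvg_at_right_filter/cF; rewrite lexx ltW.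
  + by apply/cvg_at_left_filter/cF; rewrite lexx ltW.
- move=> x; rewrite in_itv/= => /andP[ax xb].
  by rewrite derive1E; apply: derive_val; apply: dF; rewrite !ltW.
Qed.

Lemma itg_restrict a b f : itg a b f ->
  mu.-integrable setT (EFin \o (f \_ `]a, b[)).
Proof.
move=> intf; rewrite -restrict_EFin.
by apply/integrable_restrict => //=; rewrite setTI.
Qed.

Lemma cont_on_prim a b f : a <= b -> itg a b f ->
  cont_on a b (fun x => oint a x f).
Proof.
move=> ab intf.
pose h := f \_ `]a, b[.
have inth : mu.-integrable setT (EFin \o h).
  exact: itg_restrict.
have inth' : mu.-integrable `[a, b] (EFin \o h) by apply: integrableS inth.
apply: eq_cont_on (parameterized_integral_continuous ab inth').
move=> x /andP[ax xb]; rewrite /parameterized_integral -oint_closed; last first.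
  exact: integrableS inth.
apply: eq_oint => t /andP[at_ tx]; rewrite /h patchE ifT// inE/= in_itv/= at_/=.
exact: lt_le_trans xb.
Qed.

End IntervalIntegral.

(** * Exchanging the order of integration over a triangle *)

Section Triangle.
Variable R : realType.
Notation mu := (@lebesgue_measure R).
Implicit Types (a b c x y : R) (f g h k : R -> R).

Lemma integrable_prod_tensor h k :
  mu.-integrable setT (EFin \o h) -> mu.-integrable setT (EFin \o k) ->
  (mu \x mu)%E.-integrable setT (fun z => (k z.1 * h z.2)%:E).
Proof.
move=> ih ik.
have /measurable_EFinP mh := measurable_int _ ih.
have /measurable_EFinP mk := measurable_int _ ik.
apply/integrable12ltyP.
  apply/measurable_EFinP; apply: measurable_funM.
    exact: (measurableT_comp mk measurable_fst).
  exact: (measurableT_comp mh measurable_snd).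
have [mih lih] := integrableP _ _ _ ih.
have [mik lik] := integrableP _ _ _ ik.
under eq_integral => x _.
  under eq_integral => y _ do rewrite /= normrM EFinM.
  rewrite ge0_integralZl//=; last first.
    by apply/measurable_EFinP; exact: measurableT_comp.
  over.
rewrite ge0_integralZr//=; last 2 first.
- by apply/measurable_EFinP; exact: measurableT_comp.
- exact: integral_ge0.
rewrite lte_mul_pinfty//; first exact: integral_ge0.
apply/fin_numPlt; rewrite lik andbT (@lt_le_trans _ _ 0%E)//.
exact: integral_ge0.
Qed.

Lemma integral_fin_restrict a b f (g : R -> \bar R) :
  (forall x, g x = ((f \_ `]a, b[) x)%:E) ->
  fine (\int[mu]_x g x) = oint a b f.
Proof.
move=> gf; rewrite /oint Rintegral_mkcond /Rintegral.
by congr fine; apply: eq_integral => x _; rewrite gf.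
Qed.

(** Both sides integrate [h y * k x] over the triangle [a < x < y < b]. *)
Lemma oint_triangle a b h k : itg a b h -> itg a b k ->
  oint a b (fun y => h y * oint a y k) = oint a b (fun x => oint x b h * k x).
Proof.
move=> ih ik.
pose h0 := h \_ `]a, b[; pose k0 := k \_ `]a, b[.
have ih0 : mu.-integrable setT (EFin \o h0).
  exact: itg_restrict.
have ik0 : mu.-integrable setT (EFin \o k0).
  exact: itg_restrict.
have /measurable_EFinP mh := measurable_int _ ih0.
have /measurable_EFinP mk := measurable_int _ ik0.
pose H (z : R * R) := if z.1 < z.2 then k0 z.1 * h0 z.2 else 0.
have mH : measurable_fun setT H.
  apply: measurable_fun_ifT => //.
  - by apply: measurable_fun_ltr; [exact: measurable_fst|exact: measurable_snd].
  - apply: measurable_funM.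
      exact: (measurableT_comp mk measurable_fst).
    exact: (measurableT_comp mh measurable_snd).
have iH : (mu \x mu)%E.-integrable setT (EFin \o H).
  apply: le_integrable (integrable_prod_tensor ih0 ik0) => //.
    exact/measurable_EFinP.
  move=> z _; rewrite lee_fin /H; case: ifP => // _.
  by rewrite normr0.
have E1 x : (\int[mu]_y (EFin \o H) (x, y) =
    (((fun x => oint x b h * k x) \_ `]a, b[) x)%:E)%E.
  rewrite patchE; case: ifPn => [|xab]; last first.
    apply: integral0_eq => y _; rewrite /= /H /= /k0 patchE (negbTE xab) mul0r.
    by case: ifP.
  rewrite inE/= in_itv/= => /andP[ax xb].
  have ihx : itg x b h by apply: itg_sub ih => //; exact: ltW.
  transitivity (\int[mu]_y ((fun y => k x * h y) \_ `]x, b[ y)%:E)%E.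
    apply: eq_integral => y _; rewrite /= /H /= /k0 /h0 !patchE.
    rewrite mem_set/=; last by rewrite in_itv/= ax xb.
    have [xy|yx] := ltP x y.
      have -> : (y \in `]a, b[%classic) = (y \in `]x, b[%classic).
        by apply/idP/idP; rewrite !inE/= !in_itv/= xy ?(lt_trans ax xy).
      by case: ifP => // _; rewrite mulr0.
    by rewrite ifF//; apply/negbTE; rewrite notin_setE/= in_itv/= ltNge yx.
  have ikh : itg x b (fun y => k x * h y) by exact: itgZ.
  rewrite mulrC -(ointZ _ ihx) /oint Rintegral_mkcond /Rintegral fineK//.
  exact: (integrable_fin_num _ (itg_restrict ikh)).
have E2 y : (\int[mu]_x (EFin \o H) (x, y) =
    (((fun y => h y * oint a y k) \_ `]a, b[) y)%:E)%E.
  rewrite patchE; case: ifPn => [|yab]; last first.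
    apply: integral0_eq => x _; rewrite /= /H /= /h0 patchE (negbTE yab) mulr0.
    by case: ifP.
  rewrite inE/= in_itv/= => /andP[ay yb].
  have iky : itg a y k by apply: itg_sub ik => //; exact: ltW.
  transitivity (\int[mu]_x ((fun x => h y * k x) \_ `]a, y[ x)%:E)%E.
    apply: eq_integral => x _; rewrite /= /H /= /k0 /h0 !patchE.
    rewrite [y \in _]mem_set/=; last by rewrite in_itv/= ay yb.
    have [xy|yx] := ltP x y.
      have -> : (x \in `]a, b[%classic) = (x \in `]a, y[%classic).
        by apply/idP/idP; rewrite !inE/= !in_itv/= xy ?(lt_trans xy yb) => /andP[->].
      by case: ifP => // _; rewrite ?mul0r// mulrC.
    by rewrite ifF//; apply/negbTE; rewrite notin_setE/= in_itv/= andbC ltNge yx.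
  have ikh : itg a y (fun x => h y * k x) by exact: itgZ.
  rewrite -(ointZ _ iky) /oint Rintegral_mkcond /Rintegral fineK//.
  exact: (integrable_fin_num _ (itg_restrict ikh)).
rewrite -(integral_fin_restrict E1) -(integral_fin_restrict E2).
by congr fine; apply/esym; exact: Fubini.
Qed.

(** Integration by parts for two absolutely continuous functions, expressed
    through their derivatives [h] and [k], which are merely integrable. *)
Lemma oint_by_parts a b h k : itg a b h -> itg a b k ->
  oint a b (fun x => h x * oint a x k) + oint a b (fun x => oint a x h * k x) =
  oint a b h * oint a b k.
Proof.
move=> ih ik; have [ab|ba] := leP a b; last first.
  by rewrite !(@oint_empty _ a b) ?ltW// addr0 mul0r.
have iP : itg a b (fun x => oint a x h * k x).
  exact/itgM_cont/ik/cont_on_prim.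
rewrite oint_triangle// -ointD//; last first.
  apply: (@eq_itg _ _ _ (fun x => oint a b h * k x - oint a x h * k x)).
    move=> x /andP[ax xb].
    by rewrite (@oint_split _ a b x h) ?ltW//; ring.
  by apply: itgB => //; exact: itgZ.
rewrite -ointZ//; apply: eq_oint => x /andP[ax xb].
by rewrite (@oint_split _ a b x h) ?ltW//; ring.
Qed.

End Triangle.

(** * Square-integrable functions *)

Section SquareIntegrable.
Variable R : realType.
Notation mu := (@lebesgue_measure R).
Implicit Types (a b c x : R) (f g v w : R -> R).

Lemma L2P a b v : L2 `]a, b[ v <->
  measurable_fun `]a, b[ v /\ itg a b (fun x => v x ^+ 2).
Proof.
split=> [Lv|[mv iv]].
- split.
    move: (Lv); rewrite /L2 inE => /andP[/[!inE]/= mv _].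
    by apply/(measurable_restrictT _ _).2 => //; exact: mv.
  have : mu.-integrable `]a, b[ (EFin \o (fun x => (v \_ `]a, b[) x ^+ 2)).
    by apply: integrableS (Lfun2_integrable_sqr Lv).
  apply: eq_integrable => //= x xD.
  by rewrite patchE xD.
- rewrite /L2 inE; apply/andP; split; rewrite inE/=.
    exact/(measurable_restrictT _ _).1.
  rewrite /finite_norm unlock poweR_lty//.
  have [_] := integrableP _ _ _ (itg_restrict iv).
  congr (_ < _)%E; apply: eq_integral => x _.
  rewrite /= powR_mulrn// patchE; case: ifPn => xD; last first.
    by rewrite patchE (negbTE xD) -[point]/(0 : R) normr0 expr0n.
  by rewrite patchE xD normrX.
Qed.

Lemma L2_meas a b v : L2 `]a, b[ v -> measurable_fun `]a, b[ v.
Proof. by move/L2P => -[]. Qed.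

Lemma L2_sqr a b v : L2 `]a, b[ v -> itg a b (fun x => v x ^+ 2).
Proof. by move/L2P => -[]. Qed.

Lemma L2_mul a b v w : L2 `]a, b[ v -> L2 `]a, b[ w ->
  itg a b (fun x => v x * w x).
Proof.
move=> Lv Lw; apply: le_integrable (itgD (L2_sqr Lv) (L2_sqr Lw)) => //.
  by apply/measurable_EFinP/measurable_funM; exact: L2_meas.
move=> x _; rewrite lee_fin/= ler_norml ger0_norm; last first.
  by rewrite addr_ge0// sqr_ge0.
have := sqr_ge0 (v x + w x); have := sqr_ge0 (v x - w x).
have := sqr_ge0 (v x); have := sqr_ge0 (w x).
by move=> h1 h2 h3 h4; apply/andP; split; nra.
Qed.

Lemma eq_L2 a b v w : (forall x, a < x < b -> v x = w x) ->
  L2 `]a, b[ v -> L2 `]a, b[ w.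
Proof.
move=> vw /L2P[mv iv]; apply/L2P; split.
  apply: eq_measurable_fun mv => x; rewrite inE/= in_itv/= => xab.
  exact: vw.
by apply: eq_itg iv => x xab; rewrite vw.
Qed.

Lemma L2_sub a b c d v : a <= c -> d <= b -> L2 `]a, b[ v -> L2 `]c, d[ v.
Proof.
move=> ac db /L2P[mv iv]; apply/L2P; split; last exact: itg_sub iv.
apply: measurable_funS mv => //.
by apply: subset_itv; rewrite bnd_simp.
Qed.

Lemma L2_cont a b v : cont_on a b v -> L2 `]a, b[ v.
Proof.
move=> cv; apply/L2P; split; first exact: cont_on_meas.
apply: eq_itg (itg_cont (cont_onM cv cv)) => x _.
by rewrite expr2.
Qed.

Lemma L2_itg a b v : L2 `]a, b[ v -> itg a b v.
Proof.
move=> Lv; have := L2_mul Lv (L2_cont (@cont_on_cst _ a b 1)).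
by apply: eq_itg => x _; rewrite mulr1.
Qed.

Lemma L2D a b v w : L2 `]a, b[ v -> L2 `]a, b[ w ->
  L2 `]a, b[ (fun x => v x + w x).
Proof.
move=> Lv Lw; apply/L2P; split.
  by apply: measurable_funD; exact: L2_meas.
apply: (@eq_itg _ _ _ (fun x => (v x ^+ 2 + w x ^+ 2) + 2 * (v x * w x))).
  by move=> x _; ring.
apply: itgD; first by apply: itgD; exact: L2_sqr.
exact/itgZ/L2_mul.
Qed.

Lemma L2Z a b r v : L2 `]a, b[ v -> L2 `]a, b[ (fun x => r * v x).
Proof.
move=> Lv; apply/L2P; split.
  by apply: measurable_funM => //; exact: L2_meas.
apply: (@eq_itg _ _ _ (fun x => r ^+ 2 * v x ^+ 2)).
  by move=> x _; rewrite exprMn.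
exact/itgZ/L2_sqr.
Qed.

Lemma L2B a b v w : L2 `]a, b[ v -> L2 `]a, b[ w ->
  L2 `]a, b[ (fun x => v x - w x).
Proof.
move=> Lv Lw; apply: eq_L2 (L2D Lv (L2Z (-1) Lw)) => x _.
by rewrite mulN1r.
Qed.

Lemma L2_glue a b c v : L2 `]a, c[ v -> L2 `]c, b[ v -> a <= c -> c <= b ->
  L2 `]a, b[ v.
Proof.
move=> Lac Lcb ac cb; apply/L2P; split.
  exact: (itg_meas (itg_glue (L2_itg Lac) (L2_itg Lcb))).
exact: itg_glue (L2_sqr Lac) (L2_sqr Lcb).
Qed.

(** The discriminant of the nonnegative quadratic [t -> |t v + w|^2]. *)
Lemma oint_CauchySchwarz a b v w : L2 `]a, b[ v -> L2 `]a, b[ w ->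
  oint a b (fun x => v x * w x) ^+ 2 <=
  oint a b (fun x => v x ^+ 2) * oint a b (fun x => w x ^+ 2).
Proof.
move=> Lv Lw.
set B := oint a b _; set A := oint a b (fun x => v x ^+ 2).
set C := oint a b (fun x => w x ^+ 2).
have Q t s : 0 <= t ^+ 2 * A + 2 * t * s * B + s ^+ 2 * C.
  rewrite /A /B /C -!ointZ; [|exact: L2_sqr|exact: L2_mul|exact: L2_sqr].
  have i1 := itgZ (t ^+ 2) (L2_sqr Lv).
  have i2 := itgZ (2 * t * s) (L2_mul Lv Lw).
  have i3 := itgZ (s ^+ 2) (L2_sqr Lw).
  rewrite -ointD// -ointD//; last exact: itgD.
  apply: oint_ge0 => x _.
  have -> : t ^+ 2 * v x ^+ 2 + 2 * t * s * (v x * w x) + s ^+ 2 * w x ^+ 2 =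
    (t * v x + s * w x) ^+ 2 by ring.
  exact: sqr_ge0.
have A0 : 0 <= A by apply: oint_ge0 => x _; exact: sqr_ge0.
have C0 : 0 <= C by apply: oint_ge0 => x _; exact: sqr_ge0.
have [C00|Cn0] := eqVneq C 0; last first.
  have C1 : 0 < C by rewrite lt_neqAle eq_sym Cn0.
  have := Q C (- B); nra.
(* With [C = 0] and [B <> 0] the quadratic [A + 2 s B] takes the value [-1] at
   the [s] chosen below. *)
have [->|B0] := eqVneq B 0; first by rewrite C00 expr0n mulr0.
have := Q 1 (- (A + 1) / (2 * B)); rewrite C00.
have -> : 1 ^+ 2 * A + 2 * 1 * (- (A + 1) / (2 * B)) * B +
  (- (A + 1) / (2 * B)) ^+ 2 * 0 = -1 by field.
by rewrite ler0N1.
Qed.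

Definition nrm2 a b v : R := Num.sqrt (oint a b (fun x => v x ^+ 2)).

Lemma L2normE a b v : L2norm `]a, b[ v = nrm2 a b v.
Proof.
by congr Num.sqrt; apply: eq_oint => x _; rewrite expr2.
Qed.

Lemma nrm2_triangle a b v w : L2 `]a, b[ v -> L2 `]a, b[ w ->
  nrm2 a b (fun x => v x + w x) <= nrm2 a b v + nrm2 a b w.
Proof.
move=> Lv Lw.
have A0 : 0 <= oint a b (fun x => v x ^+ 2).
  by apply: oint_ge0 => x _; exact: sqr_ge0.
have C0 : 0 <= oint a b (fun x => w x ^+ 2).
  by apply: oint_ge0 => x _; exact: sqr_ge0.
rewrite -(@ler_sqr R) ?nnegrE ?addr_ge0 ?sqrtr_ge0//.
rewrite sqrrD !sqr_sqrtr//; last by apply: oint_ge0 => x _; exact: sqr_ge0.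
have -> : oint a b (fun x => (v x + w x) ^+ 2) =
    oint a b (fun x => v x ^+ 2) + 2 * oint a b (fun x => v x * w x)
    + oint a b (fun x => w x ^+ 2).
  rewrite -ointZ; last exact: L2_mul.
  rewrite -ointD; [|exact: L2_sqr|exact/itgZ/L2_mul].
  rewrite -ointD; [|by apply: itgD; [exact: L2_sqr|exact/itgZ/L2_mul]|exact: L2_sqr].
  by apply: eq_oint => x _; ring.
rewrite -[X in _ <= _ + X + _]mulr_natl lerD2r lerD2l; apply: ler_wpM2l => //.
rewrite /nrm2 -sqrtrM//.
apply: le_trans (ler_norm _) _.
by rewrite -sqrtr_sqr ler_wsqrtr// oint_CauchySchwarz.
Qed.

Lemma eq_nrm2 a b v w : (forall x, a < x < b -> v x = w x) ->
  nrm2 a b v = nrm2 a b w.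
Proof.
by move=> vw; congr Num.sqrt; apply: eq_oint => x xab; rewrite vw.
Qed.

End SquareIntegrable.

(** * The Poincare inequality with its sharp constant *)

Section Poincare.
Variable R : realType.
Implicit Types (a b c d m w x : R) (f g v p q phi : R -> R).

Lemma oint_primitive_sqr a b x p : a <= x <= b -> itg a b p ->
  oint a x (fun t => 2 * (p t * oint a t p)) = oint a x p ^+ 2.
Proof.
move=> /andP[ax xb] ip0.
have ipx : itg a x p by exact: itg_sub ip0.
have iPp : itg a x (fun t => p t * oint a t p).
  apply: (@eq_itg _ _ _ (fun t => oint a t p * p t)) => [t _|].
    by rewrite mulrC.
  exact/itgM_cont/ipx/cont_on_prim.
rewrite ointZ// expr2 -oint_by_parts//.
rewrite (@eq_oint _ _ _ (fun t => oint a t p * p t) (fun t => p t * oint a t p)).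
  by ring.
by move=> t _; rewrite mulrC.
Qed.

(** A solution [phi] of the Riccati equation [phi' = - w ^ 2 - phi ^ 2] on
    [[a, b]] completes the square: with [P] the primitive of [p],
    [0 <= |p - phi P|^2 = |p|^2 - w ^ 2 |P|^2], since
    [2 p P = (P ^ 2)'] and [P] vanishes at both ends. *)
Lemma riccati_poincare a b w phi p : a <= b -> L2 `]a, b[ p ->
  oint a b p = 0 ->
  (forall x, a <= x <= b -> is_derive x 1 phi (- w ^+ 2 - phi x ^+ 2)) ->
  w ^+ 2 * oint a b (fun x => oint a x p ^+ 2) <= oint a b (fun x => p x ^+ 2).
Proof.
move=> ab Lp p0 dphi.
have ip0 := L2_itg Lp.
pose P x := oint a x p; pose k x := 2 * (p x * P x).
pose psi x := - w ^+ 2 - phi x ^+ 2.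
have cphi : cont_on a b phi.
  apply: continuous_in_subspaceT => x; rewrite inE/= in_itv/= => xab.
  apply/differentiable_continuous/derivable1_diffP.
  by have /@ex_derive := dphi _ xab.
have cphi2 : cont_on a b (fun x => phi x ^+ 2).
  by apply: eq_cont_on (cont_onM cphi cphi) => x _; rewrite expr2.
have cpsi : cont_on a b psi.
  exact: cont_onB (@cont_on_cst _ a b (- w ^+ 2)) cphi2.
have cP : cont_on a b P by exact: cont_on_prim.
have cP2 : cont_on a b (fun x => P x ^+ 2).
  by apply: eq_cont_on (cont_onM cP cP) => x _; rewrite expr2.
have ik : itg a b k.
  apply: itgZ; apply: (@eq_itg _ _ _ (fun t => P t * p t)) => [t _|].
    by rewrite mulrC.
  exact: itgM_cont.
have k0 : oint a b k = 0.
  by rewrite (@oint_primitive_sqr a b)// ?p0 ?expr0n// ab lexx.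
have iphik : itg a b (fun x => phi x * k x) by exact: itgM_cont.
have ipsiP : itg a b (fun x => psi x * P x ^+ 2).
  exact/itg_cont/cont_onM.
have parts : oint a b (fun x => psi x * P x ^+ 2) +
    oint a b (fun x => phi x * k x) = 0.
  have := oint_by_parts (itg_cont cpsi) ik; rewrite k0 mulr0 => <-.
  congr (_ + _).
    apply: eq_oint => x /andP[ax xb]; rewrite (@oint_primitive_sqr a b)//.
    by rewrite !ltW.
  transitivity (oint a b (fun x => phi x * k x - phi a * k x)).
    rewrite ointB//; last exact: itgZ.
    by rewrite (ointZ (phi a) ik) k0 mulr0 subr0.
  apply: eq_oint => x /andP[ax xb].
  rewrite -mulrBl; congr (_ * _); apply/esym/oint_deriv; first exact: ltW.
    by move=> t /andP[at_ tx]; apply: dphi; rewrite at_ (le_trans tx) ?ltW.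
  by apply: cont_on_sub cpsi => //; exact: ltW.
have iP2 : itg a b (fun x => P x ^+ 2) by exact: itg_cont.
have ip2 : itg a b (fun x => p x ^+ 2) by exact: L2_sqr.
have iw : itg a b (fun x => w ^+ 2 * P x ^+ 2) by exact: itgZ.
rewrite -ointZ// -subr_ge0 -ointB//.
have -> : oint a b (fun x => p x ^+ 2 - w ^+ 2 * P x ^+ 2) =
    oint a b (fun x => (p x - phi x * P x) ^+ 2).
  transitivity (oint a b (fun x => (p x - phi x * P x) ^+ 2) +
    (oint a b (fun x => psi x * P x ^+ 2) + oint a b (fun x => phi x * k x))).
    have isq : itg a b (fun x => (p x - phi x * P x) ^+ 2).
      by apply/L2_sqr/L2B => //; exact/L2_cont/cont_onM.
    rewrite -ointD// -ointD//; last exact: itgD.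
    by apply: eq_oint => x _; rewrite /psi /k; ring.
  by rewrite parts addr0.
by apply: oint_ge0 => x _; exact: sqr_ge0.
Qed.

Lemma is_derive_affine (w m x : R) : is_derive x 1 (fun t : R => w * (t - m)) w.
Proof.
have -> : (fun t : R => w * (t - m)) = horner (w *: ('X - m%:P)).
  by apply/funext => t; rewrite hornerE/= !hornerE.
have := is_derive_poly (w *: ('X - m%:P)) x.
by rewrite derivZ derivB derivX derivC subr0 !hornerE.
Qed.

(** [- w tan (w (x - m))] with [m] the midpoint solves the Riccati equation
    as long as [w (b - a) < pi]. *)
Lemma is_derive_riccati a b w x : 0 < w -> w * (b - a) < pi -> a <= x <= b ->
  is_derive x 1 (fun t => - w * tan (w * (t - (a + b) / 2)))
    (- w ^+ 2 - (- w * tan (w * (x - (a + b) / 2))) ^+ 2).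
Proof.
move=> w0 wpi /andP[ax xb]; set m := (a + b) / 2.
have cn0 : cos (w * (x - m)) != 0.
  rewrite gt_eqF// cos_gt0_pihalf// /m; apply/andP; split.
    have : w * (a - (a + b) / 2) <= w * (x - (a + b) / 2).
      by rewrite ler_pM2l// lerD2r.
    have -> : w * (a - (a + b) / 2) = - (w * (b - a) / 2) by field.
    lra.
  have : w * (x - (a + b) / 2) <= w * (b - (a + b) / 2).
    by rewrite ler_pM2l// lerD2r.
  have -> : w * (b - (a + b) / 2) = w * (b - a) / 2 by field.
  lra.
have d1 := is_derive_affine w m x.
have d2 := is_derive_tan cn0.
have d3 := @is_derive1_comp R tan (fun t => w * (t - m)) x _ _ d2 d1.
have := is_deriveZ (- w) d3; rewrite (cos2_tan2 cn0) => d4.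
apply: is_derive_eq d4 _.
by rewrite /GRing.scale/=; ring.
Qed.

(** [w] can be taken arbitrarily close to [pi / (b - a)]. *)
Lemma poincare a b p : a < b -> L2 `]a, b[ p -> oint a b p = 0 ->
  nrm2 a b (fun x => oint a x p) <= (b - a) / pi * nrm2 a b p.
Proof.
move=> ab Lp p0; have pi0 := pi_gt0 R.
set A := nrm2 _ _ _; set B := nrm2 a b p.
have A0 : 0 <= A by exact: sqrtr_ge0.
have B0 : 0 <= B by exact: sqrtr_ge0.
have ba0 : 0 < b - a by rewrite subr_gt0.
have H w : 0 < w -> w * (b - a) < pi -> w * A <= B.
  move=> w0 wpi.
  have := riccati_poincare (ltW ab) Lp p0 (fun x => is_derive_riccati w0 wpi).
  move=> le2; rewrite -(@ler_sqr R) ?nnegrE ?mulr_ge0 ?(ltW w0)//.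
  rewrite exprMn !sqr_sqrtr//; by apply: oint_ge0 => x _; exact: sqr_ge0.
rewrite leNgt; apply/negP => BA.
have {}BA : B < pi / (b - a) * A.
  move: BA; rewrite -(ltr_pM2l (_ : 0 < pi / (b - a))) ?divr_gt0// => /le_lt_trans.
  apply; have pin : (pi : R) != 0 by rewrite gt_eqF.
  have ban : b - a != 0 by rewrite gt_eqF.
  by rewrite mulrA [X in X * B]mulrA divfK// divff// mul1r.
have A1 : 0 < A.
  rewrite lt_neqAle A0 andbT; apply/eqP => A00.
  by move: BA; rewrite -A00 mulr0 ltNge B0.
pose w := (B / A + pi / (b - a)) / 2.
have BAc : B / A < pi / (b - a) by rewrite ltr_pdivrMr.
have w0 : 0 < w.
  by rewrite divr_gt0// ltr_wpDl ?divr_ge0 ?divr_gt0.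
have wc : w < pi / (b - a) by rewrite /w; lra.
have := H w w0; rewrite -ltr_pdivlMr// wc => /(_ isT).
rewrite -ler_pdivlMr// /w; lra.
Qed.

End Poincare.

(** * Weak derivatives and continuity across a node *)

Section WeakDerivative.
Variable R : realType.
Implicit Types (a b c d e m x : R) (f g v w : R -> R) (p q : {poly R}).

Lemma eq_itg_except m a b f g : (forall x, a < x < b -> x != m -> f x = g x) ->
  itg a b f -> itg a b g.
Proof.
move=> fg intf; have [ma|am] := leP m a.
  apply: eq_itg intf => x /andP[ax xb]; apply: fg; rewrite ?ax//.
  by rewrite gt_eqF// (le_lt_trans ma).
have [bm|mb] := leP b m.
  apply: eq_itg intf => x /andP[ax xb]; apply: fg; rewrite ?ax//.
  by rewrite lt_eqF// (lt_le_trans xb).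
apply: (@itg_glue _ _ _ m).
  apply: (@eq_itg _ _ _ f) => [x /andP[ax xm]|]; last first.
    by apply: itg_sub intf => //; exact: ltW.
  by apply: fg; rewrite ?ax/= ?(lt_trans xm)// lt_eqF.
apply: (@eq_itg _ _ _ f) => [x /andP[mx xb]|]; last first.
  by apply: itg_sub intf => //; exact: ltW.
by apply: fg; rewrite ?xb/= ?(lt_trans am)// gt_eqF.
Qed.

Lemma eq_oint_except m a b f g : (forall x, a < x < b -> x != m -> f x = g x) ->
  itg a b f -> oint a b f = oint a b g.
Proof.
move=> fg intf; have intg := eq_itg_except fg intf.
have [ma|am] := leP m a.
  apply: eq_oint => x /andP[ax xb]; apply: fg; rewrite ?ax//.
  by rewrite gt_eqF// (le_lt_trans ma).
have [bm|mb] := leP b m.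
  apply: eq_oint => x /andP[ax xb]; apply: fg; rewrite ?ax//.
  by rewrite lt_eqF// (lt_le_trans xb).
rewrite !(@oint_split _ a b m) ?(ltW am) ?(ltW mb)//; congr (_ + _).
  apply: eq_oint => x /andP[ax xm].
  by apply: fg; rewrite ?ax/= ?(lt_trans xm)// lt_eqF.
apply: eq_oint => x /andP[mx xb].
by apply: fg; rewrite ?xb/= ?(lt_trans am)// gt_eqF.
Qed.

Lemma eq_L2_except m a b f g : (forall x, a < x < b -> x != m -> f x = g x) ->
  L2 `]a, b[ f -> L2 `]a, b[ g.
Proof.
move=> fg Lf; apply/L2P; split.
  exact: itg_meas (eq_itg_except fg (L2_itg Lf)).
apply: (@eq_itg_except m _ _ (fun x => f x ^+ 2)); last exact: L2_sqr.
by move=> x xab xm; rewrite fg.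
Qed.

Lemma test_functionP a b phi : test_function `]a, b[ phi ->
  [/\ phi a = 0, phi b = 0, continuous phi, continuous (derive1 phi) &
      forall x, is_derive x 1 phi (derive1 phi x)].
Proof.
move=> [dphi cphi _ supp].
have zero x : ~ `]a, b[%classic x -> phi x = 0.
  move=> xab; apply/eqP/negP => /negP phix; apply: xab.
  exact/supp/subset_closure.
split => //.
- by apply: zero; rewrite /= in_itv/= ltxx.
- by apply: zero; rewrite /= in_itv/= ltxx andbF.
- by move=> x; apply/differentiable_continuous/derivable1_diffP.
- by move=> x; rewrite derive1E; apply/derivableP.
Qed.

Lemma oint_test a b phi x : test_function `]a, b[ phi -> a <= x ->
  oint a x (derive1 phi) = phi x.
Proof.
move=> /test_functionP[phia _ _ c1 d1] ax.
by rewrite (@oint_deriv _ a x phi) ?phia ?subr0//; exact: cont_onT.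
Qed.

(** The node [m] is excluded because the functions at hand are prescribed on
    open cells only. *)
Lemma H1_grad_primitive m a b C v g : a <= b -> L2 `]a, b[ g ->
  (forall x, a < x < b -> x != m -> v x = C + oint a x g) ->
  H1_grad `]a, b[ v g.
Proof.
move=> ab Lg vg.
have ig := L2_itg Lg.
pose w x := C + oint a x g.
have cw : cont_on a b w.
  exact: cont_onD (@cont_on_cst _ a b C) (cont_on_prim ab ig).
have vw x : a < x < b -> x != m -> w x = v x by move=> *; rewrite vg.
split => //; first exact: eq_L2_except vw (L2_cont cw).
move=> phi tphi; have [phia phib cphi c1 d1] := test_functionP tphi.
have i1 : itg a b (derive1 phi) by exact/itg_cont/cont_onT.
rewrite -[LHS](@eq_oint_except m a b (fun x => w x * derive1 phi x)); first last.
- exact: itgM_cont.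
- by move=> x xab xm; rewrite vw.
have := oint_by_parts i1 ig.
rewrite (@oint_test a b phi b)// phib mul0r => parts.
have -> : oint a b (fun x => w x * derive1 phi x) =
    C * oint a b (derive1 phi) + oint a b (fun x => derive1 phi x * oint a x g).
  rewrite -ointZ// -ointD//; first last.
  - apply: (@eq_itg _ _ _ (fun x => oint a x g * derive1 phi x)).
      by move=> x _; rewrite mulrC.
    by apply: itgM_cont => //; exact: cont_on_prim.
  - exact: itgZ.
  by apply: eq_oint => x _; rewrite /w; ring.
rewrite (@oint_test a b phi b)// phib mulr0 add0r.
apply/eqP; rewrite -addr_eq0 -parts; apply/eqP; congr (_ + _).
apply: eq_oint => x /andP[ax _]; rewrite (oint_test tphi (ltW ax)).
by rewrite mulrC.
Qed.

Lemma cont_on_poly a b p : cont_on a b (horner p).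
Proof. by apply: cont_onT; exact: continuous_horner. Qed.

Lemma oint_deriv_poly a b p : a <= b -> oint a b (horner p^`()) = p.[b] - p.[a].
Proof.
by move=> ab; apply: oint_deriv => //; exact: cont_on_poly.
Qed.

Definition pw_poly m p q x : R := if x < m then p.[x] else q.[x].

Lemma L2_pw_poly a b m p q : L2 `]a, b[ (pw_poly m p q).
Proof.
have [ma|am] := leP m a.
  apply: (@eq_L2 _ _ _ (horner q)); last exact/L2_cont/cont_on_poly.
  by move=> x /andP[ax _]; rewrite /pw_poly ltNge (le_trans ma) ?ltW.
have [bm|mb] := leP b m.
  apply: (@eq_L2 _ _ _ (horner p)); last exact/L2_cont/cont_on_poly.
  by move=> x /andP[_ xb]; rewrite /pw_poly (lt_le_trans xb).
apply: (@L2_glue _ _ _ m); rewrite ?ltW//.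
  apply: (@eq_L2 _ _ _ (horner p)); last exact/L2_cont/cont_on_poly.
  by move=> x /andP[_ xm]; rewrite /pw_poly xm.
apply: (@eq_L2 _ _ _ (horner q)); last exact/L2_cont/cont_on_poly.
by move=> x /andP[mx _]; rewrite /pw_poly ltNge ltW.
Qed.

Lemma oint_pw_poly_deriv a m p q x : a <= m -> p.[m] = q.[m] -> a <= x ->
  p.[a] + oint a x (pw_poly m p^`() q^`()) = pw_poly m p q x.
Proof.
move=> am pq ax; rewrite {2}/pw_poly.
have [xm|mx] := ltP x m.
  rewrite (@eq_oint _ _ _ _ (horner p^`())); last first.
    by move=> t /andP[_ tx]; rewrite /pw_poly (lt_trans tx).
  by rewrite oint_deriv_poly// subrKC.
rewrite (@oint_split _ a x m)//; last exact/L2_itg/L2_pw_poly.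
rewrite (@eq_oint _ a m _ (horner p^`())); last first.
  by move=> t /andP[_ tm]; rewrite /pw_poly tm.
rewrite (@eq_oint _ m x _ (horner q^`())); last first.
  by move=> t /andP[mt _]; rewrite /pw_poly ltNge ltW.
by rewrite !oint_deriv_poly// pq; ring.
Qed.

Lemma H1_grad_pw_poly a m b v p q : a <= m -> m <= b -> p.[m] = q.[m] ->
  (forall x, a < x < m -> v x = p.[x]) ->
  (forall x, m < x < b -> v x = q.[x]) ->
  H1_grad `]a, b[ v (pw_poly m p^`() q^`()).
Proof.
move=> am mb pq vp vq.
apply: (@H1_grad_primitive m _ _ p.[a]); first exact: le_trans mb.
  exact: L2_pw_poly.
move=> x /andP[ax xb] xm; rewrite oint_pw_poly_deriv ?(ltW ax)// /pw_poly.
move: xm; rewrite neq_lt.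
case: (ltP x m) => [xm _|_ /= mx]; first by rewrite vp// ax.
by rewrite vq// mx.
Qed.

(** The positive part squared is C^1: its Taylor remainder is at most
    quadratic, uniformly across [0]. *)
Lemma is_derive_pospart_sqr x :
  is_derive x 1 (fun t : R => Num.max 0 t ^+ 2) (2 * Num.max 0 x).
Proof.
have rem h : `|Num.max 0 (h + x) ^+ 2 - Num.max 0 x ^+ 2 - 2 * Num.max 0 x * h|
    <= h ^+ 2.
  rewrite ler_norml; case: (leP 0 x) => x0; case: (leP 0 (h + x)) => hx0;
  by apply/andP; split; nra.
have lim : h^-1 *: (Num.max 0 (h *: (1 : R) + x) ^+ 2 - Num.max 0 x ^+ 2)
    @[h --> 0^'] --> 2 * Num.max 0 x.
  apply/cvgrPdist_le => eps eps0; near=> h.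
  have h0 : h != 0 by near: h; exact: nbhs_dnbhs_neq.
  rewrite /GRing.scale/= mulr1 distrC.
  have -> : h^-1 * (Num.max 0 (h + x) ^+ 2 - Num.max 0 x ^+ 2) - 2 * Num.max 0 x =
    h^-1 * (Num.max 0 (h + x) ^+ 2 - Num.max 0 x ^+ 2 - 2 * Num.max 0 x * h).
    by field.
  rewrite normrM normfV ler_pdivrMl ?normr_gt0//.
  apply: le_trans (rem h) _; rewrite -normr_id -real_normK ?num_real//.
  rewrite expr2 normr_id ler_wpM2l//.
  near: h; apply: dnbhs0_le; exact: eps0.
apply: DeriveDef; first by apply/cvg_ex; exists (2 * Num.max 0 x).
exact/cvg_lim.
Unshelve. all: by end_near. Qed.

Definition bump m e x : R := Num.max 0 (1 - ((x - m) / e) ^+ 2) ^+ 2.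

Lemma bump_mid m e : bump m e m = 1.
Proof. by rewrite /bump subrr mul0r expr0n subr0 max_r ?ler01// expr1n. Qed.

Lemma bump_bounds m e x : 0 <= bump m e x <= 1.
Proof.
rewrite /bump sqr_ge0/= expr_le1//; last by rewrite le_max lexx.
by rewrite ge_max ler01/= gerBl sqr_ge0.
Qed.

Lemma bump_out m e x : 0 < e -> ~~ (m - e <= x <= m + e) -> bump m e x = 0.
Proof.
move=> e0 xm; rewrite /bump max_l ?expr0n//.
rewrite subr_le0 -(@real_normK _ ((x - m) / e)) ?num_real// expr_ge1//.
rewrite normf_div (gtr0_norm e0) ler_pdivlMr// mul1r.
by move: xm; rewrite negb_and -!ltNge => /orP[] h; rewrite ler_normr; apply/orP;
  [right|left]; lra.
Qed.

Lemma test_function_bump c d m e : 0 < e -> c < m - e -> m + e < d ->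
  test_function `]c, d[ (bump m e).
Proof.
move=> e0 cm md.
pose r : {poly R} := 1 - (e^-1 *: ('X - m%:P)) ^+ 2.
have rE x : r.[x] = 1 - ((x - m) / e) ^+ 2.
  by rewrite /r !hornerE mulrC.
have dbump x : is_derive x 1 (bump m e) (2 * Num.max 0 r.[x] * r^`().[x]).
  have -> : bump m e = (fun t => Num.max 0 t ^+ 2) \o (horner r).
    by apply/funext => t; rewrite /bump /= rE.
  exact: (@is_derive1_comp R _ _ x _ _ (is_derive_pospart_sqr _) (is_derive_poly r x)).
have supp : closure [set x | bump m e x != 0] `<=` `[m - e, m + e].
  rewrite [X in _ `<=` X](closure_id _).1; last exact: interval_closed.
  apply: closure_subset.
  move=> x /=; rewrite in_itv/=; apply: contraNT => h.
  by rewrite bump_out.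
split.
- by move=> x; have /@ex_derive := dbump x.
- have -> : derive1 (bump m e) = (fun x => 2 * Num.max 0 r.[x] * r^`().[x]).
    by apply/funext => x; rewrite derive1E; apply: derive_val; exact: dbump.
  move=> x; apply: cvgM; last exact: continuous_horner.
  apply: cvgM; first exact: cvg_cst.
  apply: continuous_max; first exact: cvg_cst.
  exact: continuous_horner.
- apply: (subclosed_compact _ (@segment_compact _ (m - e) (m + e))) => //.
  exact: closed_closure.
- apply: subset_trans supp _ => x /=; rewrite !in_itv/= => /andP[h1 h2].
  by rewrite (lt_le_trans cm h1) (le_lt_trans h2 md).
Qed.

Lemma oint_bump_sqr c d m e : 0 < e -> c < m - e -> m + e < d ->
  oint c d (fun x => bump m e x ^+ 2) <= 2 * e.
Proof.
move=> e0 cm md.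
have [_ _ cb _ _] := test_functionP (test_function_bump e0 cm md).
have ib a b : itg a b (fun x => bump m e x ^+ 2).
  exact/L2_sqr/L2_cont/cont_onT.
rewrite (@oint_split _ c d (m - e)) ?(ltW cm)//; last by lra.
rewrite (@oint_split _ (m - e) d (m + e)) ?(ltW md)//; last by lra.
have oint0 a b : (forall x, a < x < b -> ~~ (m - e <= x <= m + e)) ->
    oint a b (fun x => bump m e x ^+ 2) = 0.
  move=> h; rewrite (@eq_oint _ _ _ _ (cst 0)); last first.
    by move=> x /h h'; rewrite bump_out// expr0n.
  by rewrite /oint Rintegral_cst// mul0r.
rewrite oint0 ?add0r; last first.
  by move=> x /andP[_ xm]; rewrite leNgt xm.
rewrite (oint0 (m + e)) ?addr0; last first.
  by move=> x /andP[mx _]; rewrite negb_and -!ltNge mx orbT.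
have <- : oint (m - e) (m + e) (horner ('X)^`()) = 2 * e.
  rewrite oint_deriv_poly ?hornerX; [ring|lra].
rewrite -subr_ge0 -ointB//; last exact/itg_cont/cont_on_poly.
apply: oint_ge0 => x _; rewrite derivX hornerE subr_ge0.
by have /andP[b0 b1] := bump_bounds m e x; rewrite expr_le1.
Qed.

(** A jump would turn the weak derivative into a Dirac mass, which is not
    bounded by the L2 norm: tested against narrow bumps of height [1] centred
    at [m], it contributes the jump itself, while the L2 part vanishes. *)
Lemma H1_pw_poly_continuous a m b v p q : a < m -> m < b -> H1 `]a, b[ v ->
  (forall x, a < x < m -> v x = p.[x]) ->
  (forall x, m < x < b -> v x = q.[x]) ->
  p.[m] = q.[m].
Proof.
move=> am mb [g [Lv Lg vg]] vp vq.
pose J := q.[m] - p.[m].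
pose h := pw_poly m p^`() q^`().
have Lh : L2 `]a, b[ h by exact: L2_pw_poly.
pose H x := h x - g x.
have LH : L2 `]a, b[ H by exact: L2B.
(* Subtracting the jump to the right of [m] leaves a function whose weak
   derivative is piecewise. *)
pose w x := if x < m then v x else v x - J.
have wg : H1_grad `]a, b[ w h.
  have -> : h = pw_poly m p^`() (q - J%:P)^`() by rewrite derivB derivC subr0.
  apply: H1_grad_pw_poly; rewrite ?ltW//.
  - by rewrite !hornerE /J; ring.
  - by move=> x /andP[ax xm]; rewrite /w xm vp// ax.
  - by move=> x /andP[mx xb]; rewrite /w ltNge (ltW mx)/= vq ?mx// !hornerE.
have [Lw _ {}wg] := wg.
have key phi : test_function `]a, b[ phi ->
    oint a b (fun x => H x * phi x) = - (J * phi m).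
  move=> tphi; have [phia phib cphi c1 d1] := test_functionP tphi.
  have Lphi : L2 `]a, b[ phi by exact/L2_cont/cont_onT.
  have Ld : L2 `]a, b[ (derive1 phi) by exact/L2_cont/cont_onT.
  have -> : oint a b (fun x => H x * phi x) =
      oint a b (fun x => h x * phi x) - oint a b (fun x => g x * phi x).
    rewrite -ointB; [|exact: L2_mul|exact: L2_mul].
    by apply: eq_oint => x _; rewrite mulrBl.
  have -> : oint a b (fun x => h x * phi x) =
      - oint a b (fun x => w x * derive1 phi x).
    by rewrite -[LHS]opprK; congr (- _); exact/esym/wg.
  have -> : oint a b (fun x => g x * phi x) =
      - oint a b (fun x => v x * derive1 phi x).
    by rewrite -[LHS]opprK; congr (- _); exact/esym/vg.
  rewrite opprK addrC.
  rewrite -ointB; [|exact: L2_mul|exact: L2_mul].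
  rewrite (@oint_split _ a b m) ?ltW//; last first.
    by apply: itgB; exact: L2_mul.
  rewrite (@eq_oint _ a m _ (cst 0)); last first.
    by move=> x /andP[_ xm]; rewrite /w xm subrr.
  rewrite {1}/oint Rintegral_cst// mul0r add0r.
  rewrite (@eq_oint _ m b _ (fun x => J * derive1 phi x)); last first.
    by move=> x /andP[mx _]; rewrite /w ltNge (ltW mx)/=; ring.
  rewrite ointZ; last by apply/itg_cont/cont_onT.
  rewrite (@oint_deriv _ m b phi) ?(ltW mb)//; last exact: cont_onT.
  by rewrite phib sub0r mulrN.
pose A := oint a b (fun x => H x ^+ 2).
have A0 : 0 <= A by apply: oint_ge0 => x _; exact: sqr_ge0.
have bound e : 0 < e -> a < m - e -> m + e < b -> J ^+ 2 <= A * (2 * e).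
  move=> e0 ae eb; have tb := test_function_bump e0 ae eb.
  have [_ _ cb _ _] := test_functionP tb.
  have Lb : L2 `]a, b[ (bump m e) by exact/L2_cont/cont_onT.
  have := oint_CauchySchwarz LH Lb; rewrite key// bump_mid mulr1 sqrrN.
  move=> /le_trans; apply; rewrite ler_wpM2l//.
  exact: oint_bump_sqr.
have [J0|J0] := eqVneq J 0.
  by move/eqP: J0; rewrite subr_eq0 => /eqP.
have J2 : 0 < J ^+ 2 by rewrite exprn_even_gt0.
pose e0 := J ^+ 2 / (4 * (A + 1)).
pose e := Num.min e0 (Num.min ((m - a) / 2) ((b - m) / 2)).
have e00 : 0 < e0 by rewrite divr_gt0// mulr_gt0// ltr_wpDl.
have [e1 e2 e3] : [/\ e <= e0, e <= (m - a) / 2 & e <= (b - m) / 2].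
  by rewrite /e !ge_min !lexx !orbT.
have epos : 0 < e by rewrite /e !lt_min e00/= !divr_gt0// subr_gt0.
have := bound e epos; rewrite ltrBrDr -ltrBrDl -ltrBrDl.
have -> : e < m - a by lra.
have -> : e < b - m by lra.
move=> /(_ isT isT) h1.
have : A * (2 * e) <= (A + 1) * (2 * e0) by apply: ler_pM => //; lra.
have -> : (A + 1) * (2 * e0) = J ^+ 2 / 2.
  by rewrite /e0; field; rewrite gt_eqF// ltr_wpDl.
lra.
Qed.

End WeakDerivative.

(** * The solution of the transport problem *)

Section Transport.
Variable R : realType.
Implicit Types (alpha beta b x : R) (f u : R -> R).

(** The constant makes the primitive vanish at the inflow endpoint. *)
Definition transport_sol alpha beta b f x : R :=
  b^-1 * (oint alpha x f + (if 0 < b then 0 else - oint alpha beta f)).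

Lemma cont_on_transport_sol alpha beta b f : alpha <= beta ->
  itg alpha beta f -> cont_on alpha beta (transport_sol alpha beta b f).
Proof.
move=> ab intf; apply: cont_onM; first exact: cont_on_cst.
by apply: cont_onD; [exact: cont_on_prim|exact: cont_on_cst].
Qed.

(** With [g = u - transport_sol], the primitive of [g] that vanishes at the
    outflow is an admissible test function, and integration by parts turns
    the weak form into [b |g|^2 = 0]. *)
Lemma ultra_weak_solution_unique alpha beta b f u : alpha < beta -> b != 0 ->
  L2 `]alpha, beta[ f -> ultra_weak_solution alpha beta b f u ->
  oint alpha beta (fun x => (u x - transport_sol alpha beta b f x) ^+ 2) = 0.
Proof.
move=> ab b0 Lf [Lu weak].
have intf := L2_itg Lf.
set U := transport_sol alpha beta b f.
have LU : L2 `]alpha, beta[ U.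
  by apply/L2_cont/cont_on_transport_sol => //; exact: ltW.
pose g x := u x - U x.
have Lg : L2 `]alpha, beta[ g by exact: L2B.
have intg := L2_itg Lg.
pose F := oint alpha beta f; pose G := oint alpha beta g.
pose C : R := if 0 < b then - G else 0.
pose v x := C + oint alpha x g.
have cv : cont_on alpha beta v.
  by apply: cont_onD; [exact: cont_on_cst|apply: cont_on_prim => //; exact: ltW].
have vg : H1_grad `]alpha, beta[ v g.
  by apply: (@H1_grad_primitive _ 0 _ _ C) => //; exact: ltW.
(* [C] makes [v] vanish at the outflow endpoint, whichever it is. *)
have vplus : H1_plus alpha beta b v.
  split; first by exists g.
  exists v; split => //; first by apply: aeW.
  move=> x [] [->|->]; rewrite /outer_normal eqxx.
    rewrite mulrN1 oppr_gt0 => bneg.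
    by rewrite /v /C ltNge (ltW bneg)/= oint_empty// addr0.
  rewrite gt_eqF// mulr1 => bpos.
  by rewrite /v /C bpos addNr.
have := weak _ _ vplus vg.
rewrite /ip -/(oint alpha beta (fun x => u x * (b * g x))).
rewrite -/(oint alpha beta (fun x => f x * v x)).
have iug : itg alpha beta (fun x => u x * g x) by exact: L2_mul.
have iUg : itg alpha beta (fun x => U x * g x) by exact: L2_mul.
have ipg : itg alpha beta (fun x => f x * oint alpha x g).
  apply: (@eq_itg _ _ _ (fun x => oint alpha x g * f x)).
    by move=> x _; rewrite mulrC.
  by apply: itgM_cont => //; apply: cont_on_prim => //; exact: ltW.
rewrite (@eq_oint _ _ _ _ (fun x => b * (u x * g x))); last first.
  by move=> x _; ring.
rewrite ointZ//.
pose D : R := if 0 < b then 0 else - F.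
have -> : oint alpha beta (fun x => f x * v x) =
    - (b * oint alpha beta (fun x => U x * g x)).
  rewrite (@eq_oint _ _ _ _ (fun x => C * f x + f x * oint alpha x g)); last first.
    by move=> x _; rewrite /v; ring.
  rewrite ointD ?ointZ//; last exact: itgZ.
  have /eqP := oint_by_parts intf intg.
  rewrite eq_sym -subr_eq => /eqP <-.
  have -> : oint alpha beta (fun x => oint alpha x f * g x) =
      b * oint alpha beta (fun x => U x * g x) - D * G.
    rewrite /G -!ointZ// -ointB; [|exact: itgZ|exact: itgZ].
    apply: eq_oint => x _; rewrite /U /transport_sol -/D mulrA mulrA divff//.
    by rewrite mul1r; ring.
  rewrite /C /D -/F -/G; case: ifP => _; ring.
move=> /eqP; rewrite eqr_opp => /eqP /(mulfI b0) ugUg.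
transitivity (oint alpha beta (fun x => u x * g x - U x * g x)).
  by apply: eq_oint => x _; rewrite -/U /g; ring.
by rewrite ointB// ugUg subrr.
Qed.

End Transport.

(** * Meshes and hat functions *)

Section MeshGeometry.
Variables (R : realType) (alpha beta kappa : R) (T : mesh alpha beta kappa).
Notation N := (ncell T).
Notation vx := (vertex T).
Implicit Types (i j k : nat) (x : R) (f v : R -> R).

Lemma vertex0 : vx 0 = alpha. Proof. by []. Qed.

Lemma vertex_ncell : vx N = beta.
Proof.
have [_ /eqP] := nodes_partition T.
by rewrite (last_nth beta).
Qed.

Lemma vertex_ncellS : vx N.+1 = beta.
Proof. by rewrite /vertex nth_default. Qed.

Lemma vertex_lt i : (i < N)%N -> vx i < vx i.+1.
Proof.
have [pth _] := nodes_partition T.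
by move=> iN; have /(pathP beta)/(_ i iN) := pth.
Qed.

Lemma vertex_leS i : (i <= N)%N -> vx i <= vx i.+1.
Proof.
rewrite leq_eqVlt => /predU1P[->|/vertex_lt/ltW//].
by rewrite vertex_ncell vertex_ncellS.
Qed.

Lemma vertex_le i j : (i <= j)%N -> (j <= N.+1)%N -> vx i <= vx j.
Proof.
elim: j => [|j IH]; first by rewrite leqn0 => /eqP ->.
rewrite leq_eqVlt => /predU1P[->//|]; rewrite ltnS => ij jN.
by rewrite (le_trans (IH ij (ltnW jN)))// vertex_leS.
Qed.

Lemma vertex_ge_alpha j : (j <= N.+1)%N -> alpha <= vx j.
Proof. by move=> jN; exact: (@vertex_le 0). Qed.

Lemma vertex_le_beta j : (j <= N.+1)%N -> vx j <= beta.
Proof. by move=> /vertex_le/(_ (leqnn _)); rewrite vertex_ncellS. Qed.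

Lemma ncell_gt0 : alpha < beta -> (0 < N)%N.
Proof.
rewrite lt0n => ab; apply/eqP => N0.
by move: ab; rewrite -vertex_ncell N0 vertex0 ltxx.
Qed.

Lemma oint_cells_upto k f : (k <= N)%N -> itg alpha beta f ->
  oint alpha (vx k) f = \sum_(i < k) oint (vx i) (vx i.+1) f.
Proof.
elim: k => [|k IH] kN intf; first by rewrite big_ord0 oint_empty.
rewrite big_ord_recr/= -IH//; last exact: ltnW.
apply: oint_split.
- by apply: vertex_ge_alpha; exact/ltnW/ltnW.
- exact/ltW/vertex_lt.
- by apply: itg_sub intf => //; exact/vertex_le_beta/leqW.
Qed.

Lemma oint_cells f : itg alpha beta f ->
  oint alpha beta f = \sum_(i < N) oint (vx i) (vx i.+1) f.
Proof. by move=> intf; rewrite -{1}vertex_ncell oint_cells_upto. Qed.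

(** The affine pieces of the hat function of vertex [j] on the left and on the
    right of that vertex. At a boundary vertex the patch is empty on one side;
    the constant [1] there keeps the value [1] at the vertex. *)
Definition hat_left j : {poly R} :=
  if j == 0 then 1 else (vx j - vx j.-1)^-1 *: ('X - (vx j.-1)%:P).

Definition hat_right j : {poly R} :=
  if j == N then 1 else (vx j.+1 - vx j)^-1 *: ((vx j.+1)%:P - 'X).

Lemma hat_left_vertex j : (j <= N)%N -> (hat_left j).[vx j] = 1.
Proof.
rewrite /hat_left; case: j => [|j] jN; first by rewrite hornerE.
rewrite !hornerE/= mulVf// subr_eq0 gt_eqF//; exact: vertex_lt.
Qed.

Lemma hat_right_vertex j : (j <= N)%N -> (hat_right j).[vx j] = 1.
Proof.
rewrite /hat_right leq_eqVlt; case: eqVneq => [_ _|jN /= jltN].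
  by rewrite hornerE.
rewrite !hornerE/= mulVf// subr_eq0 gt_eqF//; exact: vertex_lt.
Qed.

Lemma hat_left_prev j : (hat_left j.+1).[vx j] = 0.
Proof. by rewrite /hat_left !hornerE/= subrr mulr0. Qed.

Lemma hat_right_next j : (j < N)%N -> (hat_right j).[vx j.+1] = 0.
Proof.
by move=> jN; rewrite /hat_right ltn_eqF// !hornerE/= subrr mulr0.
Qed.

Lemma size_hat_left j : (size (hat_left j) <= 2)%N.
Proof.
rewrite /hat_left; case: ifP => _; first by rewrite size_poly1.
by rewrite (leq_trans (size_scale_leq _ _))// size_XsubC.
Qed.

Lemma size_hat_right j : (size (hat_right j) <= 2)%N.
Proof.
rewrite /hat_right; case: ifP => _; first by rewrite size_poly1.
rewrite (leq_trans (size_scale_leq _ _))//.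
by rewrite -opprB size_polyN size_XsubC.
Qed.

Lemma hat_sum j : (j < N)%N -> hat_right j + hat_left j.+1 = 1.
Proof.
move=> jN; rewrite /hat_right /hat_left ltn_eqF//= -scalerDr.
rewrite addrA subrK -polyCB -mul_polyC -polyCM.
by rewrite mulVf// subr_eq0 gt_eqF// vertex_lt.
Qed.

Lemma hat_leftE (a : 'I_N.+1) x : vx a.-1 < x < vx a -> hat a x = (hat_left a).[x].
Proof.
case: a => -[|j] jN /= /andP[ax xa]; first by have := lt_trans ax xa; rewrite ltxx.
by rewrite /hat /= ax (ltW xa)/= /hat_left !hornerE mulrC.
Qed.

Lemma hat_rightE (a : 'I_N.+1) x : vx a < x < vx a.+1 -> hat a x = (hat_right a).[x].
Proof.
move=> /andP[ax xa]; rewrite /hat leNgt ax andbF (ltW ax) xa/=.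
rewrite /hat_right; case: eqVneq => [aN|_].
  by move: (lt_trans ax xa); rewrite aN vertex_ncell vertex_ncellS ltxx.
by rewrite !hornerE mulrC.
Qed.

(** The patch of any vertex other than the two endpoints is disjoint from the cell. *)
Lemma reconstruction_cell (s : 'I_N.+1 -> R -> R) i x : (i < N)%N ->
  vx i < x < vx i.+1 ->
  reconstruction s x =
    (hat_right i).[x] * s (inord i) x + (hat_left i.+1).[x] * s (inord i.+1) x.
Proof.
move=> iN xi; have /andP[ix xi1] := xi; rewrite /reconstruction.
have iN1 : (i < N.+1)%N by exact: ltnW.
have vi : nat_of_ord (inord i : 'I_N.+1) = i by rewrite inordK.
have vi1 : nat_of_ord (inord i.+1 : 'I_N.+1) = i.+1 by rewrite inordK.
rewrite (bigD1 (inord i))//= (bigD1 (inord i.+1))/=; last first.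
  by rewrite -val_eqE/= vi vi1 gtn_eqF.
rewrite big1 ?addr0; last first.
  move=> a /andP[ai ai1]; rewrite patchE ifF//; apply/negbTE.
  rewrite notin_setE /omega/= in_itv/= => /andP[ax xa].
  have {}ai : (a : nat) != i by rewrite -vi val_eqE.
  have {}ai1 : (a : nat) != i.+1 by rewrite -vi1 val_eqE.
  have [lt_ai|le_ia] := ltnP a i.
    have := vertex_le lt_ai (ltnW iN1).
    by rewrite leNgt (lt_trans ix xa).
  have : (i.+1 <= a.-1)%N by move: a ai ai1 le_ia {ax xa} => [a /= _]; lia.
  move=> /vertex_le => /(_ _).
  have aN : (a.-1 <= N.+1)%N by have := ltn_ord a; lia.
  by move=> /(_ aN); rewrite leNgt (lt_trans ax xi1).
rewrite !patchE !ifT.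
- by rewrite /= hat_rightE ?vi// hat_leftE ?vi1.
- rewrite inE/= /omega vi1/= in_itv/= ix/= (lt_le_trans xi1)// vertex_le//.
- rewrite inE/= /omega vi/= in_itv/= xi1 andbT (le_lt_trans _ ix)//.
  by rewrite vertex_le ?leq_pred// ltnW.
Qed.

End MeshGeometry.

(** * The local problems *)

Section LocalProblems.
Variables (R : realType) (alpha beta kappa : R) (T : mesh alpha beta kappa).
Notation N := (ncell T).
Notation vx := (vertex T).
Variables (b : R) (k' : nat) (f uh : R -> R).
Hypotheses (hab : alpha < beta) (Lf : L2 `]alpha, beta[ f)
  (Luh : L2 `]alpha, beta[ uh).
Implicit Types (i j : nat) (a : 'I_N.+1) (s : R -> R) (p q pl pr rl rr r : {poly R}).

(** [pl] and [pr] represent the local solution of a vertex on the left and on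
    the right of it; at a boundary vertex one of the two sides is empty. *)
Definition vertex_pieces a s pl pr : Prop :=
  [/\ (size pl <= k'.+1)%N, (size pr <= k'.+1)%N,
      forall x, vx a.-1 < x < vx a -> s x = pl.[x],
      forall x, vx a < x < vx a.+1 -> s x = pr.[x] &
      pl.[vx a] = pr.[vx a]].

(** At an interior vertex the two pieces agree because a function of H^1 has no
    jump there; at a boundary vertex the only piece is used on both sides. *)
Lemma exists_vertex_pieces a s : broken_poly k' (patch a) s -> H1 (omega a) s ->
  exists pl pr, vertex_pieces a s pl pr.
Proof.
move=> brk h1.
have left_piece : (0 < a)%N -> exists p, (size p <= k'.+1)%N /\
    forall x, vx a.-1 < x < vx a -> s x = p.[x].
  move=> a0; have aN : (a.-1 < N)%N by have := ltn_ord a; lia.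
  have [|p [sp sE]] := brk (Ordinal aN); first by right; rewrite /= prednK.
  exists p; split=> // x xa; apply: sE.
  by rewrite /cell/= in_itv/= prednK.
have right_piece : (a < N)%N -> exists p, (size p <= k'.+1)%N /\
    forall x, vx a < x < vx a.+1 -> s x = p.[x].
  move=> aN; have [|p [sp sE]] := brk (Ordinal aN); first by left.
  by exists p; split=> // x xa; apply: sE; rewrite /cell/= in_itv/=.
have N0 := ncell_gt0 T hab.
have [a0|a0] := posnP a.
  have [|p [sp pE]] := right_piece; first by rewrite a0.
  exists p, p; split => // x; rewrite a0 /= => /andP[h1' h2].
  by have := lt_trans h1' h2; rewrite ltxx.
have [p [sp pE]] := left_piece a0.
have [aN|Na] := ltnP a N; last first.
  have aN : a = N :> nat by have := ltn_ord a; lia.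
  exists p, p; split => // x; rewrite aN vertex_ncell vertex_ncellS.
  by move=> /andP[h1' h2]; have := lt_trans h1' h2; rewrite ltxx.
have [q [sq qE]] := right_piece aN.
exists p, q; split => //.
apply: (H1_pw_poly_continuous _ _ h1 pE qE); last exact: vertex_lt.
by rewrite -{2}(prednK a0); apply: vertex_lt; rewrite prednK// ltnW.
Qed.

Lemma vertex_pred_le a : vx a.-1 <= vx a.
Proof. by rewrite vertex_le ?leq_pred// ltnW. Qed.

Lemma vertex_le_succ a : vx a <= vx a.+1.
Proof. exact/vertex_leS/(ltn_ord a). Qed.

Lemma H1_grad_hat a : H1_grad (omega a) (hat a)
  (pw_poly (vx a) (hat_left T a)^`() (hat_right T a)^`()).
Proof.
apply: H1_grad_pw_poly; [exact: vertex_pred_le|exact: vertex_le_succ|..].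
- by rewrite hat_left_vertex ?hat_right_vertex//; exact: (ltn_ord a).
- exact: hat_leftE.
- exact: hat_rightE.
Qed.

Lemma H1_grad_hatM a s pl pr : vertex_pieces a s pl pr ->
  H1_grad (omega a) (hat a \* s)
    (pw_poly (vx a) (hat_left T a * pl)^`() (hat_right T a * pr)^`()).
Proof.
move=> [_ _ sl sr lr].
apply: H1_grad_pw_poly; [exact: vertex_pred_le|exact: vertex_le_succ|..].
- by rewrite !hornerM lr hat_left_vertex ?hat_right_vertex//; exact: (ltn_ord a).
- by move=> x xa; rewrite /= hat_leftE// sl// hornerM.
- by move=> x xa; rewrite /= hat_rightE// sr// hornerM.
Qed.

Lemma broken_pw_poly a rl rr : (size rl <= k'.+1)%N -> (size rr <= k'.+1)%N ->
  broken_poly k' (patch a) (pw_poly (vx a) rl rr).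
Proof.
move=> srl srr i [ia|ia].
  exists rr; split=> // x; rewrite /cell/= in_itv/= ia => /andP[ax _].
  by rewrite /pw_poly ltNge ltW.
exists rl; split=> // x; rewrite /cell/= in_itv/= ia => /andP[_ xa].
by rewrite /pw_poly xa.
Qed.

(** Broken test functions are free to differ on the two sides of the vertex, so
    each cell of the patch can be tested on its own, by taking [rl = 0] or
    [rr = 0]. *)
Lemma local_problem_pieces a s pl pr rl rr :
  local_solution b k' f uh a s -> vertex_pieces a s pl pr ->
  (size rl <= k'.+1)%N -> (size rr <= k'.+1)%N ->
  oint (vx a.-1) (vx a) (fun x => b * (hat_left T a * pl)^`().[x] * rl.[x]) +
  oint (vx a) (vx a.+1) (fun x => b * (hat_right T a * pr)^`().[x] * rr.[x]) =
  oint (vx a.-1) (vx a) (fun x => (f x * (hat_left T a).[x] +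
    b * (hat_left T a)^`().[x] * uh x) * rl.[x]) +
  oint (vx a) (vx a.+1) (fun x => (f x * (hat_right T a).[x] +
    b * (hat_right T a)^`().[x] * uh x) * rr.[x]).
Proof.
move=> [_ _ loc] pieces srl srr.
have := loc _ _ (H1_grad_hat a) (H1_grad_hatM pieces) _
  (broken_pw_poly (a := a) srl srr).
set dps := pw_poly _ (hat_left T a * pl)^`() _.
set dh := pw_poly _ (hat_left T a)^`() _.
set v := pw_poly _ rl rr.
rewrite /ip /omega -!/(oint _ _ _).
have a1 := vertex_pred_le a; have a2 := vertex_le_succ a.
have aN : (a.+1 <= N.+1)%N by exact: (ltn_ord a).
have La g : L2 `]alpha, beta[ g -> L2 `]vx a.-1, vx a.+1[ g.
  apply: L2_sub; last exact: vertex_le_beta.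
  by apply: vertex_ge_alpha; have := ltn_ord a; lia.
pose nice x := f x * pw_poly (vx a) (hat_left T a * rl) (hat_right T a * rr) x +
  b * (uh x * pw_poly (vx a) ((hat_left T a)^`() * rl)
                             ((hat_right T a)^`() * rr) x).
have inice : itg (vx a.-1) (vx a.+1) nice.
  apply: itgD; first by apply: L2_mul; [exact: La|exact: L2_pw_poly].
  by apply: itgZ; apply: L2_mul; [exact: La|exact: L2_pw_poly].
rewrite [X in _ = X -> _](_ : _ = oint (vx a.-1) (vx a.+1) nice); last first.
  apply/esym/(@eq_oint_except _ (vx a)) => // x /andP[ax xa] xm.
  rewrite /nice /v /dh /pw_poly; case: ltP xm => [xlt _|].
    by rewrite hat_leftE ?ax// !hornerM; ring.
  rewrite le_eqVlt => /predU1P[->|mx _]; first by rewrite eqxx.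
  by rewrite hat_rightE ?mx// !hornerM; ring.
rewrite (@oint_split _ _ _ (vx a))//; last first.
  by apply: L2_mul; [apply: L2Z|]; exact: L2_pw_poly.
rewrite (@oint_split _ _ _ (vx a) nice)//.
have l := @eq_oint R (vx a.-1) (vx a); have r := @eq_oint R (vx a) (vx a.+1).
rewrite (l _ (fun x => b * (hat_left T a * pl)^`().[x] * rl.[x])); last first.
  by move=> x /andP[_ xm]; rewrite /dps /v /pw_poly xm.
rewrite (r _ (fun x => b * (hat_right T a * pr)^`().[x] * rr.[x])); last first.
  by move=> x /andP[mx _]; rewrite /dps /v /pw_poly ltNge (ltW mx).
rewrite (l nice (fun x => (f x * (hat_left T a).[x] +
    b * (hat_left T a)^`().[x] * uh x) * rl.[x])); last first.
  by move=> x /andP[_ xm]; rewrite /nice /pw_poly xm !hornerM; ring.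
rewrite (r nice (fun x => (f x * (hat_right T a).[x] +
    b * (hat_right T a)^`().[x] * uh x) * rr.[x])) //.
by move=> x /andP[mx _]; rewrite /nice /pw_poly ltNge (ltW mx)/= !hornerM; ring.
Qed.

(** Testing the local problem with [1] turns the orthogonality into the
    vanishing of the total increment of [hat a * s] over the patch. *)
Lemma orthogonality_increment a s pl pr : b != 0 ->
  local_solution b k' f uh a s -> vertex_pieces a s pl pr ->
  (forall dpsi, H1_grad (omega a) (hat a) dpsi ->
    ip (omega a) f (hat a) + ip (omega a) uh (fun x => b * dpsi x) = 0) ->
  (hat_right T a * pr).[vx a.+1] = (hat_left T a * pl).[vx a.-1].
Proof.
move=> b0 [_ _ loc] pieces orth.
have s1 : (size (1%R : {poly R}) <= k'.+1)%N by rewrite size_poly1.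
have Hh := H1_grad_hat a; have Hp := H1_grad_hatM pieces.
have := loc _ _ Hh Hp _ (broken_pw_poly (a := a) s1 s1).
have := orth _ Hh.
move: Hh Hp => [Lhat Ldh _] [_ Ldp _]; move: Lhat Ldh Ldp.
set dps := pw_poly _ (hat_left T a * pl)^`() _.
set dh := pw_poly _ (hat_left T a)^`() _.
rewrite /ip /omega -!/(oint _ _ _) => Lhat Ldh Ldp.
have La g : L2 `]alpha, beta[ g -> L2 `]vx a.-1, vx a.+1[ g.
  apply: L2_sub; first by apply: vertex_ge_alpha; have := ltn_ord a; lia.
  by apply: vertex_le_beta; exact: (ltn_ord a).
rewrite -ointD; first last.
- by apply: L2_mul; [exact: La|exact: L2Z].
- by apply: L2_mul; [exact: La|].
move=> orth0.
rewrite (@eq_oint _ _ _ _ (fun x => b * dps x)); last first.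
  by move=> x _; rewrite /pw_poly !hornerE; case: ifP => _; rewrite mulr1.
rewrite ointZ; last exact: L2_itg.
rewrite [X in _ = X -> _](_ : _ = 0); last first.
  rewrite -orth0; apply: eq_oint => x _.
  have -> : pw_poly (vx a) 1 1 x = 1 by rewrite /pw_poly !hornerE; case: ifP.
  by rewrite mulr1 [b * _ * _]mulrC.
have [_ _ _ _ lr] := pieces.
have aN : (a <= N)%N by have := ltn_ord a; lia.
have inc : (hat_left T a * pl).[vx a.-1] + oint (vx a.-1) (vx a.+1) dps =
    (hat_right T a * pr).[vx a.+1].
  rewrite oint_pw_poly_deriv; first last.
  - by apply: le_trans (vertex_le_succ a); exact: vertex_pred_le.
  - by rewrite !hornerM hat_left_vertex// hat_right_vertex// lr.
  - exact: vertex_pred_le.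
  by rewrite /pw_poly ltNge vertex_le_succ.
move=> /eqP; rewrite mulf_eq0 (negbTE b0)/= => /eqP dps0.
by rewrite -inc dps0 addr0.
Qed.

End LocalProblems.

(** * The error on each cell *)

Section CellError.
Variables (R : realType) (alpha beta kappa : R) (T : mesh alpha beta kappa).
Notation N := (ncell T).
Notation vx := (vertex T).
Variables (b : R) (k' : nat) (f uh : R -> R) (s : 'I_N.+1 -> R -> R).
Variables pl pr : nat -> {poly R}.
Hypotheses (hab : alpha < beta) (b0 : b != 0).
Hypotheses (Lf : L2 `]alpha, beta[ f) (Luh : L2 `]alpha, beta[ uh).
Hypothesis loc : forall a, local_solution b k' f uh a (s a).
Hypothesis pieces : forall j, (j <= N)%N ->
  vertex_pieces k' (inord j : 'I_N.+1) (s (inord j)) (pl j) (pr j).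
Implicit Types (j : nat) (g : R -> R) (q r : {poly R}).

Definition recon_poly j : {poly R} :=
  hat_right T j * pr j + hat_left T j.+1 * pl j.+1.

Lemma L2_cell j g : (j < N)%N -> L2 `]alpha, beta[ g -> L2 `]vx j, vx j.+1[ g.
Proof.
move=> jN; apply: L2_sub; first exact/vertex_ge_alpha/ltnW/ltnW.
by apply: vertex_le_beta; exact: leqW.
Qed.

Lemma itg_mul_poly j g q : (j < N)%N -> L2 `]alpha, beta[ g ->
  itg (vx j) (vx j.+1) (fun x => g x * q.[x]).
Proof.
move=> jN Lg; apply: L2_mul; first exact: L2_cell.
exact/L2_cont/cont_on_poly.
Qed.

Lemma recon_polyE j x : (j < N)%N -> vx j < x < vx j.+1 ->
  reconstruction s x = (recon_poly j).[x].
Proof.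
move=> jN xj; rewrite (reconstruction_cell s jN xj) /recon_poly !hornerE.
have [_ _ _ right_E _] := pieces (ltnW jN).
have [_ _ left_E _ _] := pieces jN.
rewrite inordK ?ltnS// in left_E; rewrite inordK ?ltnS ?(ltnW jN)// in right_E.
by rewrite right_E// left_E.
Qed.

Lemma size_recon_poly_deriv j : (j < N)%N ->
  (size (recon_poly j)^`() <= k'.+1)%N.
Proof.
move=> jN; have [_ spr _ _ _] := pieces (ltnW jN).
have [spl _ _ _ _] := pieces jN.
have sz (p q : {poly R}) : (size p <= 2)%N -> (size q <= k'.+1)%N ->
    (size (p * q)%R <= k'.+2)%N.
  by move=> sp sq; apply: leq_trans (size_polyMleq _ _) _; lia.
have sQ : (size (recon_poly j) <= k'.+2)%N.
  apply: leq_trans (size_polyD _ _) _; rewrite geq_max.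
  by rewrite !sz// ?size_hat_left ?size_hat_right.
rewrite /deriv; apply: leq_trans (size_poly _ _) _.
by move: sQ; case: (size _).
Qed.

Lemma recon_poly_left j : (j < N)%N -> (recon_poly j).[vx j] = (pr j).[vx j].
Proof.
move=> jN; rewrite /recon_poly hornerD !hornerM hat_left_prev mul0r addr0.
by rewrite hat_right_vertex ?mul1r// ltnW.
Qed.

Lemma recon_poly_right j : (j < N)%N ->
  (recon_poly j).[vx j.+1] = (pl j.+1).[vx j.+1].
Proof.
move=> jN; rewrite /recon_poly hornerD !hornerM hat_right_next// mul0r add0r.
by rewrite hat_left_vertex ?mul1r.
Qed.

Lemma pieces_vertex j : (j <= N)%N -> (pl j).[vx j] = (pr j).[vx j].
Proof. by move=> jN; have [_ _ _ _] := pieces jN; rewrite inordK. Qed.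

(** The local problems of the two endpoints add up: the two hat functions sum
    to [1] on the cell, so their derivatives cancel and [uh] with them. *)
Lemma recon_poly_equation j r : (j < N)%N -> (size r <= k'.+1)%N ->
  oint (vx j) (vx j.+1) (fun x => (b *: (recon_poly j)^`()).[x] * r.[x]) =
  oint (vx j) (vx j.+1) (fun x => f x * r.[x]).
Proof.
move=> jN sr.
have s0 : (size (0%R : {poly R}) <= k'.+1)%N by rewrite size_poly0.
have vanish c d g : oint c d (fun x => g x * (0 : {poly R}).[x]) = 0.
  rewrite (@eq_oint _ _ _ _ (cst 0)); first by rewrite /oint Rintegral_cst// mul0r.
  by move=> x _; rewrite horner0 mulr0.
have eqr := local_problem_pieces hab Lf Luh (loc _) (pieces (ltnW jN)) s0 sr.
have eql := local_problem_pieces hab Lf Luh (loc _) (pieces jN) sr s0.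
rewrite !vanish !add0r inordK ?ltnS ?(ltnW jN)// in eqr.
rewrite !vanish !addr0 inordK ?ltnS//= in eql.
have ip1 q : itg (vx j) (vx j.+1) (fun x => b * q.[x] * r.[x]).
  by apply/itg_cont/cont_onM; [apply: cont_onM; [exact: cont_on_cst|]|];
    exact: cont_on_poly.
have ip2 q : itg (vx j) (vx j.+1)
    (fun x => (f x * q.[x] + b * q^`().[x] * uh x) * r.[x]).
  apply: (@eq_itg _ _ _ (fun x => f x * (q * r).[x] + b * (uh x * (q^`() * r).[x]))).
    by move=> x _; rewrite !hornerM; ring.
  by apply: itgD; [|apply: itgZ]; exact: itg_mul_poly.
have : oint (vx j) (vx j.+1) (fun x => b * (hat_right T j * pr j)^`().[x] * r.[x]) +
    oint (vx j) (vx j.+1) (fun x => b * (hat_left T j.+1 * pl j.+1)^`().[x] * r.[x]) =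
    oint (vx j) (vx j.+1) (fun x => (f x * (hat_right T j).[x] +
      b * (hat_right T j)^`().[x] * uh x) * r.[x]) +
    oint (vx j) (vx j.+1) (fun x => (f x * (hat_left T j.+1).[x] +
      b * (hat_left T j.+1)^`().[x] * uh x) * r.[x]).
  by rewrite eqr eql.
rewrite -ointD// -ointD// => eq_sum.
rewrite (@eq_oint _ _ _ _ (fun x => b * (hat_right T j * pr j)^`().[x] * r.[x] +
    b * (hat_left T j.+1 * pl j.+1)^`().[x] * r.[x])); last first.
  by move=> x _; rewrite /recon_poly derivD !hornerE; ring.
rewrite eq_sum; apply: eq_oint => x _.
have h1 : (hat_right T j).[x] = 1 - (hat_left T j.+1).[x].
  have := congr1 (fun p => p.[x]) (hat_sum jN).
  by rewrite hornerD -polyC1 hornerC => <-; rewrite addrK.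
have h2 : (hat_right T j)^`().[x] = - (hat_left T j.+1)^`().[x].
  apply/eqP; rewrite -addr_eq0 -hornerD -derivD hat_sum//.
  by rewrite -polyC1 derivC horner0.
by rewrite h1 h2; ring.
Qed.

Lemma recon_poly_increment j : (j < N)%N ->
  b * ((recon_poly j).[vx j.+1] - (recon_poly j).[vx j]) =
  oint (vx j) (vx j.+1) f.
Proof.
move=> jN; have s1 : (size (1%R : {poly R}) <= k'.+1)%N by rewrite size_poly1.
rewrite -oint_deriv_poly ?ltW ?vertex_lt//.
rewrite -ointZ; last exact/itg_cont/cont_on_poly.
have := recon_poly_equation jN s1.
rewrite (@eq_oint _ _ _ _ (fun x => b * (recon_poly j)^`().[x])); last first.
  by move=> x _; rewrite !hornerE.
by move=> ->; apply: eq_oint => x _; rewrite hornerE mulr1.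
Qed.

Notation U := (transport_sol alpha beta b f).

Lemma transport_sol_increment j x : (j < N)%N -> vx j <= x -> x <= vx j.+1 ->
  U x - U (vx j) = b^-1 * oint (vx j) x f.
Proof.
move=> jN jx xj; rewrite /transport_sol -mulrBr; congr (_ * _).
rewrite (@oint_split _ alpha x (vx j))//; first by ring.
  exact/vertex_ge_alpha/ltnW/ltnW.
apply: itg_sub (L2_itg Lf) => //.
by apply: le_trans xj _; apply: vertex_le_beta; exact: leqW.
Qed.

(** By [recon_poly_increment] the two functions have the same increment over
    every cell, and both are continuous across the vertices. *)
Lemma vertex_error_constant j : (j < N)%N ->
  (recon_poly j).[vx j] - U (vx j) = (recon_poly 0).[vx 0] - U (vx 0) /\
  (recon_poly j).[vx j.+1] - U (vx j.+1) = (recon_poly 0).[vx 0] - U (vx 0).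
Proof.
have step i : (i < N)%N ->
    (recon_poly i).[vx i.+1] - U (vx i.+1) = (recon_poly i).[vx i] - U (vx i).
  move=> iN; have := transport_sol_increment iN (ltW (vertex_lt iN)) (lexx _).
  rewrite -(recon_poly_increment iN) mulrA mulVf// mul1r => /eqP.
  by rewrite subr_eq => /eqP ->; rewrite opprD opprB addrA subrKC.
elim: j => [|j IH] jN; first by rewrite step.
have [_ prev] := IH (ltnW jN).
suff eqv : (recon_poly j.+1).[vx j.+1] - U (vx j.+1) =
    (recon_poly 0).[vx 0] - U (vx 0) by rewrite step.
apply: etrans prev; congr (_ - _).
rewrite (recon_poly_left jN) (recon_poly_right (ltnW jN)).
exact/esym/pieces_vertex/ltnW.
Qed.

Hypothesis horth : forall a : 'I_N.+1,
  (vx a \in `]alpha, beta[) \/ inflow alpha beta b (vx a) ->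
  forall dpsi : R -> R, H1_grad (omega a) (hat a) dpsi ->
  ip (omega a) f (hat a) + ip (omega a) uh (fun x => b * dpsi x) = 0.

(** The orthogonality at the inflow vertex makes the reconstruction satisfy
    the boundary condition, so the two functions agree at every vertex. *)
Lemma recon_poly_vertex j : (j < N)%N -> (recon_poly j).[vx j] = U (vx j).
Proof.
move=> jN; have N0 := ncell_gt0 T hab.
apply/eqP; rewrite -subr_eq0; have [-> _] := vertex_error_constant jN.
have [bpos|] := boolP (0 < b).
  have infl : inflow alpha beta b (vx (inord 0 : 'I_N.+1)).
    rewrite inordK// /inflow/=; split; first by left.
    by rewrite /outer_normal eqxx mulrN1 oppr_lt0.
  have := orthogonality_increment hab Lf Luh b0 (loc _) (pieces (leq0n _))
    (horth (or_intror infl)).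
  rewrite inordK//= !hornerM hat_right_next// mul0r hat_left_vertex//.
  rewrite mul1r pieces_vertex// recon_poly_left// => <-.
  by rewrite /transport_sol bpos addr0 oint_empty// mulr0 subrr.
rewrite -leNgt le_eqVlt (negbTE b0)/= => bneg.
have last_lt : (N.-1 < N)%N by rewrite prednK.
have [_ <-] := vertex_error_constant last_lt.
have infl : inflow alpha beta b (vx (inord N : 'I_N.+1)).
  rewrite inordK// /inflow/= vertex_ncell; split; first by right.
  by rewrite /outer_normal eqxx gt_eqF// mulr1.
have := orthogonality_increment hab Lf Luh b0 (loc _) (pieces (leqnn _))
  (horth (or_intror infl)).
rewrite inordK// -{4}(prednK N0) !hornerM hat_left_prev mul0r.
have -> : vx N.+1 = vx N by rewrite vertex_ncellS vertex_ncell.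
rewrite hat_right_vertex// mul1r => pr0.
rewrite (recon_poly_right last_lt) prednK// pieces_vertex// pr0 vertex_ncell.
by rewrite /transport_sol ltNge (ltW bneg)/= subrr mulr0 subrr.
Qed.

(** [q1 - q2] is orthogonal to both residuals. *)
Lemma nrm2_residual_unique c d m g q1 q2 : L2 `]c, d[ g ->
  (size q1 <= m)%N -> (size q2 <= m)%N ->
  (forall r, (size r <= m)%N -> oint c d (fun x => (g x - q1.[x]) * r.[x]) = 0) ->
  (forall r, (size r <= m)%N -> oint c d (fun x => (g x - q2.[x]) * r.[x]) = 0) ->
  nrm2 c d (fun x => g x - q1.[x]) = nrm2 c d (fun x => g x - q2.[x]).
Proof.
move=> Lg s1 s2 o1 o2; congr Num.sqrt.
have Lq q : L2 `]c, d[ (horner q) by exact/L2_cont/cont_on_poly.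
have s21 : (size (q2 - q1)%R <= m)%N.
  by apply: leq_trans (size_polyD _ _) _; rewrite size_polyN geq_max s2.
have i1 := L2_sqr (L2B Lg (Lq q1)); have i2 := L2_sqr (L2B Lg (Lq q2)).
apply/eqP; rewrite -subr_eq0 -ointB//.
have -> : oint c d (fun x => (g x - q1.[x]) ^+ 2 - (g x - q2.[x]) ^+ 2) =
    oint c d (fun x => (g x - q1.[x]) * (q2 - q1).[x] +
                       (g x - q2.[x]) * (q2 - q1).[x]).
  by apply: eq_oint => x _; rewrite !hornerE; ring.
rewrite ointD; first by rewrite o1// o2// addr0.
  by apply: L2_mul => //; exact: L2B.
by apply: L2_mul => //; exact: L2B.
Qed.

Variable pf : R -> R.
Hypothesis hpf : is_L2proj T k' f pf.

(** A polynomial on one cell, extended by zero, is an admissible test function,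
    so the projection error is orthogonal to polynomials cell by cell. *)
Lemma L2proj_cell j : (j < N)%N -> exists q : {poly R},
  [/\ (size q <= k'.+1)%N, forall x, vx j < x < vx j.+1 -> pf x = q.[x] &
      forall r, (size r <= k'.+1)%N ->
        oint (vx j) (vx j.+1) (fun x => (f x - q.[x]) * r.[x]) = 0].
Proof.
move=> jN; have [brk orth] := hpf; pose i := Ordinal jN.
have [//|q [sq qE]] := brk i.
have {}qE x : vx j < x < vx j.+1 -> pf x = q.[x].
  by move=> xj; apply: qE; rewrite /cell/= in_itv/=.
exists q; split => // r sr.
pose v := (horner r) \_ (cell i).
have vbrk : @broken_poly R alpha beta kappa T k' setT v.
  move=> l _; have [->|li] := eqVneq l i.
    by exists r; split => // x xl; rewrite /v patchE mem_set.
  exists 0; split; first by rewrite size_poly0.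
  move=> x; rewrite /cell/= in_itv/= => /andP[lx xl].
  rewrite /v patchE ifF ?horner0//; apply/negbTE.
  rewrite notin_setE /cell/= in_itv/= => /andP[jx xj].
  have : (l : nat) != j by rewrite -[j]/(i : nat) val_eqE.
  rewrite neq_ltn => /orP[/(@vertex_le _ _ _ _ T)|/(@vertex_le _ _ _ _ T)].
    by move=> /(_ (leqW (ltnW jN))); rewrite leNgt (lt_trans jx xl).
  by move=> /(_ (leqW (ltnW (ltn_ord l)))); rewrite leNgt (lt_trans lx xj).
rewrite -(orth v vbrk) /ip.
rewrite (@eq_oint _ _ _ _ (fun x => (f x - pf x) * r.[x])); last first.
  by move=> x xj; rewrite qE.
rewrite /oint -/(cell i).
have {1}-> : cell i = `]alpha, beta[ `&` cell i.
  apply/esym/setIidPr; apply: subset_itv; rewrite bnd_simp.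
    exact/vertex_ge_alpha/ltnW/ltnW.
  by apply: vertex_le_beta; exact: leqW.
rewrite Rintegral_mkcondr; apply: eq_Rintegral => x _.
by rewrite /v !patchE; case: ifP => //= _; rewrite mulr0.
Qed.

(** On a cell, [U - s_h] is the primitive of [(f - b s_h') / b] and vanishes at
    both ends, so the Poincare inequality bounds it by the oscillation. *)
Lemma cell_error j : (j < N)%N ->
  nrm2 (vx j) (vx j.+1) (fun x => U x - uh x) <=
  nrm2 (vx j) (vx j.+1) (fun x => uh x - reconstruction s x) +
  (vx j.+1 - vx j) / (pi * `|b|) *
    nrm2 (vx j) (vx j.+1) (fun x => f x - pf x).
Proof.
move=> jN; set c := vx j; set d := vx j.+1.
have cd : c < d by exact: vertex_lt.
pose Q := recon_poly j; pose bQ' : {poly R} := b *: Q^`().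
have [q [sq qE qorth]] := L2proj_cell jN.
have Lfc := L2_cell jN Lf; have Luc := L2_cell jN Luh.
have LQ r : L2 `]c, d[ (horner r) by exact/L2_cont/cont_on_poly.
pose p x := b^-1 * (f x - bQ'.[x]).
have Lp : L2 `]c, d[ p by apply/L2Z/L2B.
have bQorth r : (size r <= k'.+1)%N ->
    oint c d (fun x => (f x - bQ'.[x]) * r.[x]) = 0.
  move=> sr; rewrite (@eq_oint _ _ _ _ (fun x => f x * r.[x] - bQ'.[x] * r.[x])).
    rewrite ointB; first by rewrite recon_poly_equation// subrr.
      exact: itg_mul_poly.
    exact: L2_mul.
  by move=> x _; rewrite mulrBl.
have sbQ : (size bQ' <= k'.+1)%N.
  exact: leq_trans (size_scale_leq _ _) (size_recon_poly_deriv jN).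
have errE x : c < x < d -> U x - Q.[x] = oint c x p.
  move=> /andP[cx xd]; have cx' := ltW cx; have xd' := ltW xd.
  have := transport_sol_increment jN cx' xd'.
  rewrite -(recon_poly_vertex jN) => incU.
  have incQ := @oint_deriv_poly R c x Q cx'.
  rewrite /p ointZ; last first.
    apply/L2_itg/L2B; last exact/L2_cont/cont_on_poly.
    by apply: L2_sub Lfc.
  rewrite ointB; first last.
  - exact/itg_cont/cont_on_poly.
  - by apply/L2_itg; apply: L2_sub Lfc.
  rewrite mulrBr -incU (@eq_oint _ _ _ _ (fun t => b * Q^`().[t])); last first.
    by move=> t _; rewrite /bQ' hornerE.
  rewrite ointZ; last exact/itg_cont/cont_on_poly.
  by rewrite incQ mulrA mulVf// mul1r; ring.
have p0 : oint c d p = 0.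
  rewrite /p ointZ; last by apply/L2_itg/L2B.
  have s1 : (size (1%R : {poly R}) <= k'.+1)%N by rewrite size_poly1.
  have := bQorth 1 s1; rewrite (@eq_oint _ _ _ _ (fun x => f x - bQ'.[x])).
    by move=> ->; rewrite mulr0.
  by move=> x _; rewrite -polyC1 hornerC mulr1.
have nrm_p : nrm2 c d p = `|b|^-1 * nrm2 c d (fun x => f x - pf x).
  rewrite (@eq_nrm2 _ _ _ (fun x => f x - pf x) (fun x => f x - q.[x])); last first.
    by move=> x xj; rewrite qE.
  rewrite -(nrm2_residual_unique Lfc sbQ sq bQorth qorth).
  rewrite /nrm2 (@eq_oint _ _ _ _ (fun x => b^-1 ^+ 2 * (f x - bQ'.[x]) ^+ 2)).
    rewrite ointZ; last by apply/L2_sqr/L2B.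
    by rewrite sqrtrM ?sqr_ge0// sqrtr_sqr normfV.
  by move=> x _; rewrite /p exprMn.
rewrite (@eq_nrm2 _ _ _ _ (fun x => (Q.[x] - uh x) + oint c x p)); last first.
  by move=> x xj; rewrite -errE//; ring.
apply: le_trans (nrm2_triangle _ _) _.
- exact: L2B.
- by apply/L2_cont/cont_on_prim; [exact: ltW|exact: L2_itg].
apply: lerD.
  rewrite le_eqVlt; apply/orP; left; apply/eqP; congr Num.sqrt.
  by apply: eq_oint => x xj; rewrite (recon_polyE jN xj) -sqrrN opprB.
apply: le_trans (poincare cd Lp p0) _.
by rewrite nrm_p mulrA invfM mulrA.
Qed.

End CellError.

(** * The error bound *)

Theorem theorem6p1 (R : realType) (alpha beta b kappa : R)
  (hab : alpha < beta) (hb : b != 0)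
  (T : mesh alpha beta kappa) (k' : nat)
  (f u uh : R -> R)
  (hf : L2 `]alpha, beta[ f)
  (hu : ultra_weak_solution alpha beta b f u)
  (huh : L2 `]alpha, beta[ uh)
  (horth : forall a : 'I_(ncell T).+1,
     (vertex T a \in `]alpha, beta[) \/ inflow alpha beta b (vertex T a) ->
     forall dpsi : R -> R, H1_grad (omega a) (hat a) dpsi ->
     ip (omega a) f (hat a) + ip (omega a) uh (fun x => b * dpsi x) = 0)
  (s : 'I_(ncell T).+1 -> R -> R)
  (hs : forall a, local_solution b k' f uh a (s a))
  (pf : R -> R) (hpf : is_L2proj T k' f pf) :
  L2norm `]alpha, beta[ (u \- uh) <= eta T b f pf uh (reconstruction s).
Proof.
have [Lu _] := hu.
pose U := transport_sol alpha beta b f.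
have LU : L2 `]alpha, beta[ U.
  by apply/L2_cont/cont_on_transport_sol; [exact: ltW|exact: L2_itg].
have /choice[pq pieces] : forall j, exists pq : {poly R} * {poly R},
    (j <= ncell T)%N ->
    vertex_pieces k' (inord j : 'I_(ncell T).+1) (s (inord j)) pq.1 pq.2.
  move=> j; have [sbrk sH1 _] := hs (inord j).
  have [pl [pr plr]] := exists_vertex_pieces hab sbrk sH1.
  by exists (pl, pr).
rewrite L2normE (@eq_nrm2 _ _ _ _ (fun x => (u x - U x) + (U x - uh x))); last first.
  by move=> x _; rewrite /=; ring.
apply: le_trans (nrm2_triangle _ _) _; [exact: L2B|exact: L2B|].
rewrite {1}/nrm2 (ultra_weak_solution_unique hab hb hf hu) sqrtr0 add0r.
have iUuh := L2_sqr (L2B LU huh).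
rewrite /nrm2 /eta (oint_cells T iUuh) ler_wsqrtr//; apply: ler_sum => i _.
have err := @cell_error R alpha beta kappa T b k' f uh s (fun j => (pq j).1)
  (fun j => (pq j).2) hab hb hf huh hs pieces horth pf hpf i (ltn_ord i).
rewrite -[leLHS]sqr_sqrtr; last by apply: oint_ge0 => x _; exact: sqr_ge0.
rewrite /eta_NC /eta_Osc /cell !L2normE ler_sqr ?nnegrE ?sqrtr_ge0//.
by apply: le_trans _ err; exact: sqrtr_ge0.
Qed.
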